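(* Let $\varphi$ be a crystalline anisotropy on $\mathbb{R}^2$, let $\alpha>0$, and let $\{\Gamma(t)\}_{t\ge0}$ be the maximal (in time) crystalline elastic flow, with finitely many restarts, starting from a closed admissible polygonal curve. Assume that there exist $T\ge0$ and $a_0>0$ such that $$\inf_{t\ge T}\ \min_i\ \mathcal{H}^1(S_i(t))\ge a_0>0,$$ where $S_i(t)$ are the segments of $\Gamma(t)$. Then there exists a stationary polygonal curve $\Gamma^\infty$, parallel to $\Gamma(T)$, such that $\Gamma(t)$ Kuratowski converges to $\Gamma^\infty$ as $t\to+\infty$.
   Context: Anisotropy. An anisotropy is a convex, positively one-homogeneous function $\varphi:\mathbb{R}^2\to[0,\infty)$ with $c|x|\le\varphi(x)\le C|x|$ for some $0<c\le C<\infty$; $W^\varphi=\{\varphi\le1\}$ and $\varphi^o(x)=\max_{y\in W^\varphi}\langle x,y\rangle$. It is crystalline if $W^\varphi$ is a polygon, whose edges are called facets; $\nu_F$ is the outward unit normal of the facet $F$. $\mathcal{H}^1$ is length. Polygonal curves. All curves are oriented and may self-intersect. A closed polygonal curve is a closed consecutive union $\Gamma=\bigcup_{i=1}^nS_i$ of finitely many segments of positive length, indices being cyclic ($S_0=S_n$, $S_{n+1}=S_1$, likewise for all indexed quantities); consecutive segments are not parallel. $\nu_{S_i}$ is the unit tangent (in the direction of the parametrization) rotated counterclockwise by $90^\circ$. The angle $\theta_i$ between $S_{i-1}$ and $S_i$ is taken in $(0,\pi)$ if $S_{i-1},S_i$ form a convex cone for which $\nu_{S_{i-1}},\nu_{S_i}$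 are inner normals, and in $(\pi,2\pi)$ otherwise (for a convex polygon with outward normals, $\theta_i$ is $2\pi$ minus the interior angle). Admissibility. $\Gamma$ is admissible if (for a suitable orientation) each $\nu_{S_i}$ equals $\nu_{F_i}$ for a (unique) facet $F_i$ of $W^\varphi$, and for consecutive $S_{i-1},S_i$ the facets $F_{i-1},F_i$ have a common vertex. The transition number $c_i$ of $S_i$ is $+1$ if $\theta_i,\theta_{i+1}\in(\pi,2\pi)$, $-1$ if $\theta_i,\theta_{i+1}\in(0,\pi)$, and $0$ otherwise. The $\varphi$-curvature on $S_i$ is $c_i\mathcal{H}^1(F_i)/\mathcal{H}^1(S_i)$. Set $\delta_j=\mathcal{H}^1(F_j)^2\varphi^o(\nu_{S_j})$ and $$E_i(\Gamma)=c_i\mathcal{H}^1(F_i)+\alpha\Big(\frac{c_{i-1}^2\delta_{i-1}}{\mathcal{H}^1(S_{i-1})^2\sin\theta_i}+\frac{c_i^2\delta_i[\cot\theta_i+\cot\theta_{i+1}]}{\mathcal{H}^1(S_i)^2}+\frac{c_{i+1}^2\delta_{i+1}}{\mathcal{H}^1(S_{i+1})^2\sin\theta_{i+1}}\Big).$$ $\Gamma$ is stationary if $E_i(\Gamma)=0$ for all $i$. Parallel curves. $\bar\Gamma=\bigcup_{i=1}^n\bar S_i$ is parallel to $\Gamma=\bigcup_{i=1}^nS_i$ if each $\bar S_i$ is a nondegenerate segment parallel to $S_i$ with $\nu_{\bar S_i}=\nu_{S_i}$. For parallel segments $S,T$ on lines $\ell_S,\ell_T$, $H(S,T)$ is the vector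 orthogonal to them with $\ell_T=\ell_S+H(S,T)$. Flow. A family $\{\Gamma(t)\}_{t\in[0,T)}$ is a crystalline elastic flow starting from $\Gamma^0=\bigcup_{i=1}^nS_i^0$ if $\Gamma(t)=\bigcup_{i=1}^nS_i(t)$ is parallel to $\Gamma^0$ for all $t$, and $h_i(t)=\langle H(S_i^0,S_i(t)),\nu_{S_i^0}\rangle$ belong to $C^0([0,T))\cap C^1(0,T)$, $h_i(0)=0$, and $h_i'=-\varphi^o(\nu_{S_i^0})\,E_i(\Gamma(t))/\mathcal{H}^1(S_i(t))$ in $(0,T)$ for each $i$. Flow with restarts. From every closed admissible polygonal curve there starts a unique flow up to a maximal time; if this time is finite, $\Gamma(t)$ Kuratowski converges there to an admissible polygonal curve (some segments with zero $\varphi$-curvature having vanished), from which (after relabelling its segments) the flow is restarted. This happens only finitely many times, and yields the unique family $\{\Gamma(t)\}_{t\ge0}$, Kuratowski continuous in $[0,+\infty)$, referred to as the maximal flow with finitely many restarts. Kuratowski convergence is that of closed subsets of $\mathbb{R}^2$. *)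

(* Defs.v *)
From HB Require Import structures.
From mathcomp Require Import all_boot all_order all_algebra.
From mathcomp Require Import all_classical all_reals all_analysis.

Set Implicit Arguments.
Unset Strict Implicit.
Unset Printing Implicit Defensive.

Import Order.TTheory GRing.Theory Num.Theory.
Import numFieldNormedType.Exports.

Local Open Scope classical_set_scope.
Local Open Scope ring_scope.

Notation plane R := 'rV[R]_2.

Definition dot (R : realType) (u v : plane R) : R := (u *m v^T) 0 0.

(* The norm provided by the library on row vectors is the sup norm; lengths are
   measured with the Euclidean one. *)
Definition enorm (R : realType) (u : plane R) : R := Num.sqrt (dot u u).

(* Counterclockwise rotation by 90 degrees. *)
Definition rot90 (R : realType) (u : plane R) : plane R :=
  \row_(j < 2) (if j == 0 then - u 0 1 else u 0 0).

Definition cot (R : realType) (x : R) : R := cos x / sin x.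

(* [S.1] is the initial endpoint and [S.2] the final one. *)
Notation segment R := (plane R * plane R)%type.

Definition seg_set (R : realType) (S : segment R) : set (plane R) :=
  [set S.1 + t *: (S.2 - S.1) | t in `[0, 1]].

Definition seg_line (R : realType) (S : segment R) : set (plane R) :=
  [set S.1 + t *: (S.2 - S.1) | t in setT].

Definition len (R : realType) (S : segment R) : R := enorm (S.2 - S.1).

Definition tangent (R : realType) (S : segment R) : plane R :=
  (len S)^-1 *: (S.2 - S.1).

Definition normal (R : realType) (S : segment R) : plane R := rot90 (tangent S).

Definition parallel_seg (R : realType) (S T : segment R) : Prop :=
  dot (rot90 (S.2 - S.1)) (T.2 - T.1) = 0.

(* H(S,T); the set below is a singleton when S and T are nondegenerate and
   parallel. *)
Definition displacement (R : realType) (S T : segment R) : plane R :=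
  get [set v : plane R |
    [/\ dot v (S.2 - S.1) = 0, dot v (T.2 - T.1) = 0
      & seg_line T = [set x + v | x in seg_line S]]].

(* Angle in (0,2pi) between consecutive segments S and T, where S.2 = T.1.
   The cone spanned by the directions S.1 - S.2 and T.2 - T.1 has the normals
   of S and T as inner normals iff both scalar products below are positive. *)
Definition angle (R : realType) (S T : segment R) : R :=
  let u := S.1 - S.2 in
  let w := T.2 - T.1 in
  let a := acos (dot u w / (enorm u * enorm w)) in
  if (0 < dot (normal S) w) && (0 < dot (normal T) u) then a else 2 * pi - a.

Definition anisotropy (R : realType) (phi : plane R -> R) : Prop :=
  [/\ forall x, 0 <= phi x,
      convex_function (setT : set (convex_lmodType (plane R))) phi,
      forall (a : R) x, 0 <= a -> phi (a *: x) = a * phi x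
    & exists c C : R, 0 < c /\
        forall x, c * enorm x <= phi x /\ phi x <= C * enorm x].

Definition wulff (R : realType) (phi : plane R -> R) : set (plane R) :=
  [set x | phi x <= 1].

Definition polar (R : realType) (phi : plane R -> R) (x : plane R) : R :=
  sup [set dot x y | y in wulff phi].

(* A polygon is the convex hull of a finite set of points (the Wulff shape of
   an anisotropy is bounded with nonempty interior, so no degenerate case
   arises). *)
Definition polygon (R : realType) (W : set (plane R)) : Prop :=
  exists2 V : set (plane R), finite_set V &
    W = smallest (fun A : set (plane R) =>
                    convex_set (A : set (convex_lmodType (plane R)))) V.

Definition crystalline (R : realType) (phi : plane R -> R) : Prop :=
  anisotropy phi /\ polygon (wulff phi).

(* Facets are represented as oriented segments, with the (clockwise)
   orientation for which [normal F] is the outward unit normal: F is the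
   nondegenerate face of the Wulff shape exposed by [normal F]. *)
Definition is_facet (R : realType) (phi : plane R -> R) (F : segment R) : Prop :=
  F.1 <> F.2 /\
  seg_set F = [set x | wulff phi x /\
    forall y, wulff phi y -> dot y (normal F) <= dot x (normal F)].

(* The facet with the same normal as S (unique when it exists). *)
Definition facet (R : realType) (phi : plane R -> R) (S : segment R) :
  segment R := get [set F | is_facet phi F /\ normal F = normal S].

Definition common_vertex (R : realType) (F G : segment R) : Prop :=
  [set F.1; F.2] `&` [set G.1; G.2] !=set0.

(* A closed curve with n segments is given by its vertices p_0, ..., p_(n-1);
   [ordS] and [ord_pred] are the cyclic successor and predecessor on 'I_n, so
   the i-th segment goes from p_i to p_(i+1), indices being cyclic. *)
Definition edge (R : realType) n (p : 'I_n -> plane R) (i : 'I_n) : segment R :=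
  (p i, p (ordS i)).

Definition closed_polygonal (R : realType) n (p : 'I_n -> plane R) : Prop :=
  [/\ (0 < n)%N,
      forall i, p i <> p (ordS i)
    & forall i, ~ parallel_seg (edge p (ord_pred i)) (edge p i)].

(* theta_i, at the common endpoint p_i of the segments i-1 and i *)
Definition theta (R : realType) n (p : 'I_n -> plane R) (i : 'I_n) : R :=
  angle (edge p (ord_pred i)) (edge p i).

(* The orientation of an admissible curve is the one encoded by the order of
   its vertices. *)
Definition admissible (R : realType) (phi : plane R -> R) n
    (p : 'I_n -> plane R) : Prop :=
  let F i := facet phi (edge p i) in
  (forall i, is_facet phi (F i) /\ normal (edge p i) = normal (F i)) /\
  (forall i, common_vertex (F (ord_pred i)) (F i)).

Definition transition (R : realType) n (p : 'I_n -> plane R) (i : 'I_n) : R :=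
  if (theta p i \in `]pi, 2 * pi[) && (theta p (ordS i) \in `]pi, 2 * pi[)
  then 1
  else if (theta p i \in `]0, pi[) && (theta p (ordS i) \in `]0, pi[)
  then -1 else 0.

Definition curvature (R : realType) (phi : plane R -> R) n
    (p : 'I_n -> plane R) (i : 'I_n) : R :=
  transition p i * len (facet phi (edge p i)) / len (edge p i).

Definition delta (R : realType) (phi : plane R -> R) n
    (p : 'I_n -> plane R) (j : 'I_n) : R :=
  len (facet phi (edge p j)) ^+ 2 * polar phi (normal (edge p j)).

Definition elastic_term (R : realType) (phi : plane R -> R) (alpha : R) n
    (p : 'I_n -> plane R) (i : 'I_n) : R :=
  let c := transition p in
  let d := delta phi p in
  let L j := len (edge p j) in
  let th := theta p in
  c i * len (facet phi (edge p i)) +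
  alpha *
   (c (ord_pred i) ^+ 2 * d (ord_pred i)
      / (L (ord_pred i) ^+ 2 * sin (th i))
    + c i ^+ 2 * d i * (cot (th i) + cot (th (ordS i))) / L i ^+ 2
    + c (ordS i) ^+ 2 * d (ordS i)
      / (L (ordS i) ^+ 2 * sin (th (ordS i)))).

Definition stationary (R : realType) (phi : plane R -> R) (alpha : R) n
    (p : 'I_n -> plane R) : Prop :=
  [/\ closed_polygonal p, admissible phi p
    & forall i, elastic_term phi alpha p i = 0].

Definition parallel_curve (R : realType) n (p q : 'I_n -> plane R) : Prop :=
  forall i, [/\ q i <> q (ordS i), parallel_seg (edge p i) (edge q i)
              & normal (edge q i) = normal (edge p i)].

(* Along a flow with restarts the number of segments changes. *)
Record curve (R : realType) : Type := Curve {
  nseg : nat;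
  vertex :> 'I_nseg -> plane R }.

Definition curve_set (R : realType) (G : curve R) : set (plane R) :=
  \bigcup_i seg_set (edge G i).

Definition min_len (R : realType) (G : curve R) : \bar R :=
  \big[Order.min/+oo%E]_i (len (edge G i))%:E.

Definition lower_limit (R : realType) (F : set_system R)
    (A : R -> set (plane R)) : set (plane R) :=
  [set x | forall U, nbhs x U -> \forall t \near F, A t `&` U !=set0].

Definition upper_limit (R : realType) (F : set_system R)
    (A : R -> set (plane R)) : set (plane R) :=
  [set x | forall U B, nbhs x U -> F B -> exists2 t, B t & A t `&` U !=set0].

Definition kuratowski_cvg (R : realType) (F : set_system R)
    (A : R -> set (plane R)) (L : set (plane R)) : Prop :=
  lower_limit F A = L /\ upper_limit F A = L.

(* [p] is a flow on [0,T) starting from [p0]; only the values of [p] on [0,T)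
   matter. *)
Definition elastic_flow (R : realType) (phi : plane R -> R) (alpha : R) n
    (p0 : 'I_n -> plane R) (p : R -> 'I_n -> plane R) (T : \bar R) : Prop :=
  let h i t :=
    dot (displacement (edge p0 i) (edge (p t) i)) (normal (edge p0 i)) in
  [/\ (0 < T)%E,
      forall t, 0 <= t -> (t%:E < T)%E -> parallel_curve p0 (p t)
    & forall i,
      [/\ h i 0 = 0,
          {within [set t : R | 0 <= t /\ (t%:E < T)%E], continuous (h i)},
          forall t, 0 < t -> (t%:E < T)%E -> derivable (h i) t 1,
          {within [set t : R | 0 < t /\ (t%:E < T)%E], continuous (derive1 (h i))}
        & forall t, 0 < t -> (t%:E < T)%E ->
            derive1 (h i) t =
              - polar phi (normal (edge p0 i)) * elastic_term phi alpha (p t) i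
              / len (edge (p t) i)]].

Definition maximal_flow (R : realType) (phi : plane R -> R) (alpha : R) n
    (p0 : 'I_n -> plane R) (p : R -> 'I_n -> plane R) (T : \bar R) : Prop :=
  elastic_flow phi alpha p0 p T /\
  forall (q : R -> 'I_n -> plane R) (T' : \bar R),
    elastic_flow phi alpha p0 q T' -> (T' <= T)%E.

(* Restarts occur at tau_1 < ... < tau_k, with tau_0 = 0 and tau_(k+1) = +oo
   (see [tend]). The value G(tau_j) is the relabelled curve from which the flow
   is restarted; Kuratowski continuity makes it the limit of the previous piece
   as t increases to tau_j. *)
Definition flow_with_restarts (R : realType) (phi : plane R -> R) (alpha : R)
    (G0 : curve R) (G : R -> curve R) : Prop :=
  exists (k : nat) (tau : nat -> R),
  let tend j : \bar R := if j == k then +oo%E else (tau j.+1)%:E in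
  [/\ G 0 = G0,
      tau 0%N = 0,
      forall j, (j < k)%N -> tau j < tau j.+1,
      forall j, (j <= k)%N ->
        exists (n : nat) (p : R -> 'I_n -> plane R),
          [/\ closed_polygonal (p 0),
              admissible phi (p 0),
              maximal_flow phi alpha (p 0) p (tend j - (tau j)%:E)%E,
              forall t, tau j <= t -> (t%:E < tend j)%E ->
                G t = Curve (p (t - tau j))
            & (j < k)%N ->
                let vanishes i :=
                  len (edge (p t) i) @[t --> (tau j.+1 - tau j)^'-] --> (0 : R)
                in
                (exists i, vanishes i) /\
                (forall i, vanishes i -> curvature phi (p 0) i = 0)]
    & forall t : R, 0 <= t ->
        kuratowski_cvg (within [set s : R | 0 <= s] (nbhs t))
          (fun s => curve_set (G s)) (curve_set (G t))].

(* Main.v *)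
Require Import Defs.
From HB Require Import structures.
From mathcomp Require Import all_boot all_order all_algebra.
From mathcomp Require Import all_classical all_reals all_analysis.
From mathcomp Require Import ring lra.

(* A segment can vanish only at a restart, so after time [T] there is a single
   flow of curves parallel to a fixed one. In terms of the signed distances [k]
   of the lines carrying the segments, the lengths are [L = M k] with [M]
   symmetric, and the flow is [k_i' = - (phi^o_i / L_i) E_i], where
   [E = l - alpha M (m_j / L_j^2)_j], [l_j = c_j H^1(F_j)] and
   [m_j = c_j^2 delta_j]. Since [sum_i phi^o_i L_i = sum_i l_i k_i], [E] is the
   gradient of the energy [sum phi^o_i L_i + alpha sum m_i / L_i], which is
   convex in [k]. It decreases, so the lengths stay bounded and [E] comes
   arbitrarily close to 0; by compactness there are lengths [z] with [E = 0].
   The excess of the energy over its tangent at [z] is comparable with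
   [sum m_i (L_i - z_i)^2] and, by strong convexity, bounded by a multiple of
   [|E|^2]: hence it decays exponentially, so does [|k'|], and [k] converges. *)

Set Implicit Arguments.
Unset Strict Implicit.
Unset Printing Implicit Defensive.

Import Order.TTheory GRing.Theory Num.Theory.
Import numFieldNormedType.Exports.

Local Open Scope classical_set_scope.
Local Open Scope ring_scope.

(** * Gradient flow of a convex energy *)

(** Cauchy-Schwarz from Lagrange's identity: the double sum of the squares of
    [a i * b j - a j * b i] is twice the difference of the two sides. *)
Lemma sqr_sum_mul_le (R : realFieldType) n (a b : 'I_n -> R) :
  (\sum_j a j * b j) ^+ 2 <= (\sum_j a j ^+ 2) * (\sum_j b j ^+ 2).
Proof.
have : 0 <= \sum_i \sum_j (a i * b j - a j * b i) ^+ 2.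
  by apply: sumr_ge0 => i _; apply: sumr_ge0 => j _; exact: sqr_ge0.
have -> : \sum_i \sum_j (a i * b j - a j * b i) ^+ 2 =
    \sum_i \sum_j (a i ^+ 2 * b j ^+ 2) + \sum_i \sum_j (b i ^+ 2 * a j ^+ 2)
    - 2 * \sum_i \sum_j ((a i * b i) * (a j * b j)).
  rewrite mulr_sumr -big_split -sumrB /=; apply: eq_bigr => i _.
  rewrite mulr_sumr -big_split -sumrB /=; apply: eq_bigr => j _.
  ring.
rewrite -subr_ge0 expr2 !big_distrlr /=.
have -> : \sum_i \sum_j b i ^+ 2 * a j ^+ 2 = \sum_i \sum_j a i ^+ 2 * b j ^+ 2.
  by rewrite exchange_big /=; apply: eq_bigr => i _; apply: eq_bigr => j _; rewrite mulrC.
by move=> h; lra.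
Qed.

(** * Differential inequalities on a half-line *)

Lemma is_derive_bigsum (R : realType) n (h : 'I_n -> R -> R) (x : R) (dh : 'I_n -> R) :
  (forall i, is_derive x 1 (h i) (dh i)) ->
  is_derive x 1 (fun t => \sum_i h i t) (\sum_i dh i).
Proof.
move=> H; have := is_derive_sum H.
by rewrite (_ : \sum_i h i = fun t => \sum_i h i t) // funeqE => t; rewrite fct_sumE.
Qed.

Lemma nonincreasing_of_derive_le0 (R : realType) (f df : R -> R) (T : R) :
  (forall t, T <= t -> is_derive t 1 f (df t)) ->
  (forall t, T <= t -> df t <= 0) ->
  forall s t, T <= s -> s <= t -> f t <= f s.
Proof.
move=> H D s t Ts st.
have H' x : x \in `]s, t[ -> is_derive x 1 f (df x).
  by rewrite in_itv /= => /andP[sx _]; apply: H; rewrite (le_trans Ts)// ltW.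
have [|c] := @MVT_segment _ f df s t st H'.
  apply: continuous_in_subspaceT => x; rewrite inE /= in_itv /= => /andP[sx _].
  apply: differentiable_continuous; apply/derivable1_diffP.
  by have := H x (le_trans Ts sx); case.
rewrite in_itv /= => /andP[sc _] e; rewrite -subr_le0 e mulr_le0_ge0 ?subr_ge0//.
by apply: D; rewrite (le_trans Ts).
Qed.

(** Gronwall: [f s * expR (c * s)] is nonincreasing. *)
Lemma exp_decay (R : realType) (f df : R -> R) (T c : R) :
  (forall t, T <= t -> is_derive t 1 f (df t)) ->
  (forall t, T <= t -> df t <= - c * f t) ->
  forall t, T <= t -> f t <= f T * expR (c * T) * expR (- c * t).
Proof.
move=> H D t Tt.
pose g (s : R) : R := f s * expR (c * s).
have Hg s : T <= s -> is_derive s 1 g ((df s + c * f s) * expR (c * s)).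
  move=> Ts; have ? := H _ Ts.
  apply: is_derive_eq; rewrite /GRing.scale /=; ring.
have : g t <= g T.
  apply: (nonincreasing_of_derive_le0 Hg _ (lexx T) Tt) => s Ts.
  rewrite pmulr_lle0 ?expR_gt0//.
  by have := D _ Ts; rewrite mulNr; lra.
rewrite /g -ler_pdivlMr ?expR_gt0// => /le_trans; apply.
by rewrite mulNr expRN.
Qed.

Lemma expRN_cvg0 (R : realType) (c : R) : 0 < c ->
  expR (- c * t) @[t --> +oo] --> (0 : R).
Proof.
move=> c0.
under eq_fun do rewrite mulNr.
apply: (cvg_comp _ _ _ (@cvgr_expR R)).
by apply: gt0_cvgMry.
Qed.

(** With [e] the integral over [[t, +oo[] of the bound on the derivative, [f + e] is nonincreasing
    and [f - e] nondecreasing. Each bounds the other, so [f + e] converges, and [e] tends to 0. *)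
Lemma cvg_of_derive_exp_bound (R : realType) (f df : R -> R) (T c K : R) :
  0 < c -> (forall t, T <= t -> is_derive t 1 f (df t)) ->
  (forall t, T <= t -> `|df t| <= K * expR (- c * t)) ->
  exists l : R, f t @[t --> +oo] --> l.
Proof.
move=> c0 H D.
pose e (t : R) : R := K / c * expR (- c * t).
have He (t : R) : is_derive t 1 e (- K * expR (- c * t)).
  by apply: is_derive_eq; rewrite /GRing.scale /=; field; rewrite gt_eqF.
pose g (t : R) : R := f t + e t.
pose h (t : R) : R := - (f t - e t).
have Hg t : T <= t -> is_derive t 1 g (df t - K * expR (- c * t)).
  by move=> Tt; have ? := H _ Tt; have ? := He t; apply: is_derive_eq; ring.
have Hh t : T <= t -> is_derive t 1 h (- df t - K * expR (- c * t)).
  by move=> Tt; have ? := H _ Tt; have ? := He t; apply: is_derive_eq; ring.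
have Dg := nonincreasing_of_derive_le0 Hg.
have Dh := nonincreasing_of_derive_le0 Hh.
have {}Dg s t : T <= s -> s <= t -> g t <= g s.
  by apply: Dg => u /D; rewrite ler_norml => /andP[]; lra.
have {}Dh s t : T <= s -> s <= t -> h t <= h s.
  by apply: Dh => u /D; rewrite ler_norml => /andP[]; lra.
have K0 : 0 <= K.
  have := D T (lexx T) => /(le_trans (normr_ge0 _)).
  by rewrite pmulr_lge0 ?expR_gt0.
have e0 t : 0 <= e t by rewrite /e mulr_ge0 ?divr_ge0 ?expR_ge0// ltW.
(* Freezing [g] before [T] makes the function monotone on the whole line. *)
pose G (t : R) : R := - g (Num.max T t).
have cG : G t @[t --> +oo] --> sup (range G).
  apply: nondecreasing_cvgr.
    move=> s t st; rewrite /G lerN2; apply: Dg; first by rewrite le_max lexx.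
    by rewrite ge_max !le_max lexx st /= orbT.
  exists (h T) => _ [t _ <-]; rewrite /G.
  have := Dh T (Num.max T t) (lexx T); rewrite le_max lexx => /(_ isT).
  have := e0 (Num.max T t).
  by rewrite /h /g; lra.
exists (- sup (range G) - K / c * 0).
have : - G t - e t @[t --> +oo] --> - sup (range G) - K / c * 0.
  apply: cvgB; first exact: cvgN.
  by apply: cvgM; [exact: cvg_cst | exact: expRN_cvg0].
apply: cvg_trans; apply: near_eq_cvg; near=> t.
by rewrite /G /g opprK max_r ?addrK.
Unshelve. all: by end_near.
Qed.

(** * Gradient of the energy and its comparison with the distance to a zero *)

(** For symmetric [M], this is the gradient in [k] of [\sum_i l i * k i + alpha * \sum_j m j / w j],
    where [w = M k], expressed through the lengths [w]. *)
Definition residual (R : realType) n (M : 'I_n -> 'I_n -> R) (l m : 'I_n -> R)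
    (alpha : R) (w : 'I_n -> R) (i : 'I_n) : R :=
  l i - alpha * \sum_j M i j * (m j / w j ^+ 2).

(** A squared distance that ignores the lengths of zero weight, on which [residual] does not
    depend. *)
Definition gap (R : realType) n (m w z : 'I_n -> R) : R :=
  \sum_j m j * (w j - z j) ^+ 2.

Lemma gap_ge0 (R : realType) n (m w z : 'I_n -> R) :
  (forall j, 0 <= m j) -> 0 <= gap m w z.
Proof. by move=> m0; apply: sumr_ge0 => j _; rewrite mulr_ge0 ?sqr_ge0. Qed.

(** The quotient is the factor in [1 / z^2 - 1 / w^2 = (w - z) * (w + z) / (w^2 * z^2)], so these
    are two-sided bounds on the slope of [- 1 / w^2] over [[a, b]]. *)
Lemma inv_sqr_diff_bounds (R : realType) (a b w z : R) :
  0 < a -> a <= w <= b -> a <= z <= b ->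
  2 * a / b ^+ 4 <= (w + z) / (w ^+ 2 * z ^+ 2) <= 2 * b / a ^+ 4.
Proof.
move=> a0 /andP[aw wb] /andP[az zb].
have w0 : 0 < w by lra.
have z0 : 0 < z by lra.
have b0 : 0 < b by lra.
have wz0 : 0 < w ^+ 2 * z ^+ 2 by rewrite mulr_gt0 ?exprn_gt0.
apply/andP; split; apply: ler_pM; rewrite ?invr_ge0 ?(ltW wz0) ?exprn_ge0//; try lra.
  rewrite lef_pV2 ?posrE ?exprn_gt0// (exprD _ 2 2).
  by apply: ler_pM; rewrite ?exprn_ge0 ?lerXn2r ?nnegrE ?(ltW w0, ltW z0, ltW a0, ltW b0).
rewrite lef_pV2 ?posrE ?exprn_gt0// (exprD _ 2 2).
by apply: ler_pM; rewrite ?exprn_ge0 ?lerXn2r ?nnegrE ?(ltW w0, ltW z0, ltW a0, ltW b0).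
Qed.

Lemma residualE (R : realType) n (M : 'I_n -> 'I_n -> R) (l m : 'I_n -> R)
    (alpha : R) (w z : 'I_n -> R) (i : 'I_n) :
  (forall j, w j != 0) -> (forall j, z j != 0) ->
  residual M l m alpha z i = 0 ->
  residual M l m alpha w i = alpha * \sum_j M i j *
    (m j * (w j - z j) * ((w j + z j) / (w j ^+ 2 * z j ^+ 2))).
Proof.
move=> w0 z0 /subr0_eq e; rewrite /residual e -mulrBr -sumrB; congr (_ * _).
by apply: eq_bigr => j _; field; rewrite w0 z0.
Qed.

(** By [residualE] the residual is [alpha] times [M] applied to a vector [v]. Cauchy-Schwarz bounds
    it by the norms of [M] and [v]; in [v j ^+ 2] one factor [m j] is kept for the gap and the other
    is bounded by the sum [S] of all weights. *)
Lemma residual_le_gap (R : realType) n (M : 'I_n -> 'I_n -> R) (l m : 'I_n -> R)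
    (alpha a b : R) : 0 < a -> (forall j, 0 <= m j) ->
  exists2 C : R, 0 < C & forall w z : 'I_n -> R,
    (forall j, a <= w j <= b) -> (forall j, a <= z j <= b) ->
    (forall i, residual M l m alpha z i = 0) ->
    \sum_i residual M l m alpha w i ^+ 2 <= C * gap m w z.
Proof.
move=> a0 m0.
pose g := 2 * b / a ^+ 4; pose N := \sum_i \sum_j M i j ^+ 2.
pose S := \sum_j m j.
have N0 : 0 <= N by apply: sumr_ge0 => i _; apply: sumr_ge0 => j _; exact: sqr_ge0.
have S0 : 0 <= S by exact: sumr_ge0.
(* The [+ 1] serves only to make the constant positive. *)
exists (alpha ^+ 2 * (N * (S * g ^+ 2)) + 1).
  by rewrite ltr_pwDr// mulr_ge0 ?sqr_ge0// mulr_ge0// mulr_ge0 ?sqr_ge0.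
move=> w z aw az ez.
have wn0 j : w j != 0 by have /andP[? _] := aw j; rewrite gt_eqF//; lra.
have zn0 j : z j != 0 by have /andP[? _] := az j; rewrite gt_eqF//; lra.
have G0 := gap_ge0 w z m0.
pose v j := m j * (w j - z j) * ((w j + z j) / (w j ^+ 2 * z j ^+ 2)).
have vle : \sum_j v j ^+ 2 <= S * g ^+ 2 * gap m w z.
  rewrite /gap mulr_sumr; apply: ler_sum => j _.
  have /andP[gl gu] := inv_sqr_diff_bounds a0 (aw j) (az j).
  have b0 : 0 < b by have /andP[? ?] := aw j; lra.
  rewrite /v; set q := (w j + z j) / _.
  have -> : (m j * (w j - z j) * q) ^+ 2 = m j * (m j * (w j - z j) ^+ 2 * q ^+ 2).
    by ring.
  have -> : S * g ^+ 2 * (m j * (w j - z j) ^+ 2) =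
    S * (m j * (w j - z j) ^+ 2 * g ^+ 2) by ring.
  have g0 : 0 <= q.
    apply: le_trans gl; rewrite divr_ge0 ?exprn_ge0 ?(ltW b0)//.
    by rewrite mulr_ge0 ?(ltW a0).
  apply: ler_pM => //.
  - by rewrite mulr_ge0 ?sqr_ge0// mulr_ge0 ?sqr_ge0.
  - by rewrite /S (bigD1 j)//= lerDl sumr_ge0.
  - apply: ler_wpM2l; first by rewrite mulr_ge0 ?sqr_ge0.
    by rewrite lerXn2r ?nnegrE// (le_trans g0).
rewrite mulrDl mul1r -[leLHS]addr0 lerD//.
apply: (@le_trans _ _ (alpha ^+ 2 * (N * \sum_j v j ^+ 2))).
  rewrite /N mulr_suml mulr_sumr; apply: ler_sum => i _.
  rewrite (residualE wn0 zn0 (ez i)) exprMn ler_wpM2l ?sqr_ge0//.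
  exact: sqr_sum_mul_le.
rewrite -(mulrA (_ ^+ 2)) -(mulrA N) ler_wpM2l ?sqr_ge0//.
by rewrite ler_wpM2l.
Qed.

(** The columns are weighted so that, for symmetric [M], the row [k] is sent to the row of the
    [m j * L j], where [L = M k]. *)
Definition weighted_mx (R : realType) n (M : 'I_n -> 'I_n -> R) (m : 'I_n -> R) :
  'M[R]_n := \matrix_(i, j) (M i j * m j).

(* Its kernel (acting on rows) is the row space of [weighted_mx M m]. *)
Definition range_defect (R : realType) n (M : 'I_n -> 'I_n -> R) (m : 'I_n -> R) :
  'M[R]_n := 1%:M - pinvmx (weighted_mx M m) *m weighted_mx M m.

Definition weighted_row (R : realType) n (m w : 'I_n -> R) : 'rV[R]_n :=
  \row_j (m j * w j).

Lemma weighted_row_range (R : realType) n (M : 'I_n -> 'I_n -> R) (m k : 'I_n -> R) :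
  (forall i j, M i j = M j i) ->
  weighted_row m (fun i => \sum_j M i j * k j) *m range_defect M m = 0.
Proof.
move=> Ms.
have -> : weighted_row m (fun i => \sum_j M i j * k j) = (\row_j k j) *m weighted_mx M m.
  apply/rowP => j; rewrite !mxE mulr_sumr; apply: eq_bigr => i _.
  by rewrite !mxE (Ms j); ring.
by rewrite /range_defect mulmxBr mulmx1 -mulmxA (mulmxA (weighted_mx M m)) mulmxKpV ?subrr.
Qed.

(* The Polyak-Lojasiewicz inequality: the energy is strongly convex in the
   lengths that carry a positive weight, and these are linear in [k]. *)
Lemma gap_le_residual (R : realType) n (M : 'I_n -> 'I_n -> R) (l m : 'I_n -> R)
    (alpha a b : R) :
  (forall i j, M i j = M j i) -> 0 < alpha -> 0 < a -> (forall j, 0 <= m j) ->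
  exists2 C : R, 0 < C & forall k z : 'I_n -> R,
    let w i := \sum_j M i j * k j in
    (forall j, a <= w j <= b) -> (forall j, a <= z j <= b) ->
    (forall i, residual M l m alpha z i = 0) ->
    weighted_row m z *m range_defect M m = 0 ->
    gap m w z <= C * \sum_i residual M l m alpha w i ^+ 2.
Proof.
move=> Ms al0 a0 m0.
pose c := 2 * a / b ^+ 4; pose P := pinvmx (weighted_mx M m).
pose B := \sum_i \sum_j P j i ^+ 2.
pose S := \sum_j m j.
have B0 : 0 <= B by apply: sumr_ge0 => i _; apply: sumr_ge0 => j _; exact: sqr_ge0.
have S0 : 0 <= S by exact: sumr_ge0.
exists (B * S / (alpha * c) ^+ 2 + 1).
  by rewrite ltr_pwDr// !mulr_ge0// invr_ge0 sqr_ge0.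
move=> k z w aw az ez rz.
have wn0 j : w j != 0 by have /andP[? _] := aw j; rewrite gt_eqF//; lra.
have zn0 j : z j != 0 by have /andP[? _] := az j; rewrite gt_eqF//; lra.
set E := residual M l m alpha w; set y := gap m w z.
have y0 : 0 <= y by exact: gap_ge0.
set E2 := \sum_i E i ^+ 2.
have E20 : 0 <= E2 by apply: sumr_ge0 => i _; exact: sqr_ge0.
pose d := weighted_row m w - weighted_row m z.
have dj j : d 0 j = m j * (w j - z j) by rewrite !mxE; ring.
(* A substitute for the difference of signed distances between [w] and [z]: it produces the same
   weighted row [d] and, unlike [k], is bounded in terms of [d]. *)
pose x := d *m P.
have xd : x *m weighted_mx M m = d.
  have : d *m range_defect M m = 0 by rewrite mulmxBl rz weighted_row_range// subrr.
  by rewrite /range_defect mulmxBr mulmx1 mulmxA => /subr0_eq <-.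
have xM j : m j * (\sum_i M i j * x 0 i) = m j * (w j - z j).
  rewrite -dj -xd mxE mulr_sumr; apply: eq_bigr => i _; rewrite !mxE; ring.
(* Exchanging the sums lets [M] act on [x], which by [xM] gives [w j - z j] wherever the weight is
   nonzero. The pairing of [x] with the gradient thus becomes a weighted sum of squares. *)
have xE : \sum_i x 0 i * E i = alpha *
    \sum_j (w j + z j) / (w j ^+ 2 * z j ^+ 2) * (m j * (w j - z j) ^+ 2).
  under eq_bigr do rewrite /E (residualE wn0 zn0 (ez _)) mulrCA.
  rewrite -mulr_sumr; congr (_ * _).
  under eq_bigr do rewrite mulr_sumr.
  rewrite exchange_big /=; apply: eq_bigr => j _.
  set q := (w j + z j) / _.
  have -> : m j * (w j - z j) ^+ 2 = (m j * (\sum_i M i j * x 0 i)) * (w j - z j).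
    by rewrite xM; ring.
  rewrite !mulr_sumr mulr_suml mulr_sumr.
  by apply: eq_bigr => i _; ring.
have xx : \sum_i x 0 i ^+ 2 <= B * (S * y).
  apply: (@le_trans _ _ (B * \sum_j d 0 j ^+ 2)).
    rewrite /B mulr_suml; apply: ler_sum => i _.
    by rewrite mxE mulrC; exact: sqr_sum_mul_le.
  rewrite ler_wpM2l// /y /gap mulr_sumr; apply: ler_sum => j _.
  rewrite dj exprMn expr2 -mulrA ler_wpM2r ?(mulr_ge0 (m0 j) (sqr_ge0 _))//.
  by rewrite /S (bigD1 j)//= lerDl sumr_ge0.
have lb : alpha * c * y <= \sum_i x 0 i * E i.
  rewrite xE -mulrA ler_wpM2l ?(ltW al0)// /y /gap mulr_sumr; apply: ler_sum => j _.
  have /andP[gl _] := inv_sqr_diff_bounds a0 (aw j) (az j).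
  by rewrite ler_wpM2r// mulr_ge0 ?sqr_ge0.
have [->|yn0] := eqVneq y 0.
  by rewrite mulr_ge0// addr_ge0// !mulr_ge0// invr_ge0 sqr_ge0.
have {yn0}y_gt0 : 0 < y by rewrite lt_neqAle eq_sym yn0.
(* For [n = 0] nothing constrains [b]; a positive [y] provides an index, hence [b > 0]. *)
have c0 : 0 < c.
  have [j _] : exists j : 'I_n, true.
    apply/existsP; apply: contraLR isT => /existsPn h.
    by move: y_gt0; rewrite /y /gap big1 ?ltxx// => j; have := h j.
  have /andP[? ?] := aw j.
  by rewrite /c !mulr_gt0 ?invr_gt0 ?exprn_gt0//; lra.
have ac0 : 0 < alpha * c by rewrite mulr_gt0.
(* Square [lb], apply Cauchy-Schwarz and [xx], then cancel one factor [y]. *)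
have key : (alpha * c) ^+ 2 * y <= B * S * E2.
  rewrite -(ler_pM2r y_gt0).
  have -> : (alpha * c) ^+ 2 * y * y = (alpha * c * y) ^+ 2 by ring.
  apply: (@le_trans _ _ ((\sum_i x 0 i * E i) ^+ 2)).
    have ? : 0 <= alpha * c * y by rewrite mulr_ge0// ltW.
    by rewrite lerXn2r ?nnegrE// (le_trans _ lb).
  apply: (le_trans (sqr_sum_mul_le _ _)).
  have -> : B * S * E2 * y = B * (S * y) * E2 by ring.
  by rewrite ler_wpM2r.
rewrite mulrDl mul1r -[y]addr0 lerD// mulrAC ler_pdivlMr ?exprn_gt0//.
by rewrite mulrC.
Qed.

Lemma bigsum_cvg (R : realType) (T : Type) (F : set_system T) (FF : Filter F) n
    (f : 'I_n -> T -> R) (l : 'I_n -> R) :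
  (forall i, f i t @[t --> F] --> l i) ->
  \sum_i f i t @[t --> F] --> \sum_i l i.
Proof. by move=> H; apply: cvg_big => //; exact: add_continuous. Qed.

Lemma residual_cvg (R : realType) (T : Type) (F : set_system T) (FF : Filter F) n
    (M : 'I_n -> 'I_n -> R) (l m : 'I_n -> R) (alpha : R)
    (w : 'I_n -> T -> R) (z : 'I_n -> R) (i : 'I_n) :
  (forall j, w j t @[t --> F] --> z j) -> (forall j, z j != 0) ->
  residual M l m alpha (w^~ t) i @[t --> F] --> residual M l m alpha z i.
Proof.
move=> wz z0; apply: cvgB; first exact: cvg_cst.
apply: cvgM; first exact: cvg_cst.
apply: bigsum_cvg => j; apply: cvgM; first exact: cvg_cst.
apply: cvgM; first exact: cvg_cst.
by apply: cvgV; [rewrite expf_neq0|rewrite expr2; apply: cvgM].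
Qed.

(* The minimizer over the box of the sum of squares of both quantities is a
   common zero. *)
Lemma residual_zero_exists (R : realType) n (M : 'I_n -> 'I_n -> R)
    (l m : 'I_n -> R) (alpha a b : R) :
  (forall i j, M i j = M j i) -> 0 < a ->
  (forall e, 0 < e -> exists k : 'I_n -> R,
    let w i := \sum_j M i j * k j in
    (forall j, a <= w j <= b) /\ \sum_i residual M l m alpha w i ^+ 2 < e) ->
  exists z : 'I_n -> R, [/\ forall j, a <= z j <= b,
    forall i, residual M l m alpha z i = 0 &
    weighted_row m z *m range_defect M m = 0].
Proof.
move=> Ms a0 H.
(* The signed distances [k] in [H] come without a bound, so compactness is applied to the lengths.
   The second sum is a continuous record of the fact that they come from some [k]. *)
pose f (w : 'rV[R]_n) : R := \sum_i residual M l m alpha (w 0) i ^+ 2 +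
  \sum_j (weighted_row m (w 0) *m range_defect M m) 0 j ^+ 2.
pose A := [set w : 'rV[R]_n | forall i, `[a, b]%classic (w 0 i)].
have cA : compact A.
  by apply: (@rV_compact _ n (fun=> `[a, b]%classic)) => i; exact: segment_compact.
have fk k : let w i := \sum_j M i j * k j in
    f (\row_j w j) = \sum_i residual M l m alpha w i ^+ 2.
  move=> w; have -> : f (\row_j w j) = \sum_i residual M l m alpha w i ^+ 2 +
    \sum_j (weighted_row m w *m range_defect M m) 0 j ^+ 2.
    by rewrite /f (_ : (\row_j w j) 0 = w)// funeqE => j; rewrite mxE.
  by rewrite weighted_row_range// [X in _ + X]big1 ?addr0// => j _; rewrite mxE expr0n.
have Ak k : let w i := \sum_j M i j * k j in
    (forall j, a <= w j <= b) -> A (\row_j w j).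
  by move=> w aw i /=; rewrite in_itv /= mxE; exact: aw.
have A0 : A !=set0.
  have [k [aw _]] := H 1 ltr01.
  by exists (\row_j \sum_i M j i * k i); exact: Ak.
have cf : {within A, continuous f}.
  apply: continuous_in_subspaceT => w; rewrite inE => Aw.
  have cw j : (v : 'rV[R]_n) 0 j @[v --> w] --> w 0 j by exact: coord_continuous.
  apply: cvgD; first exact: nbhs_filter.
    apply: (@bigsum_cvg _ _ (nbhs w) _ _
      (fun i (v : 'rV[R]_n) => residual M l m alpha (v 0) i ^+ 2)) => i; rewrite expr2.
    have rc : residual M l m alpha (v 0) i @[v --> w] --> residual M l m alpha (w 0) i.
      apply: (@residual_cvg _ _ (nbhs w) _ _ M l m alpha (fun j v => (v : 'rV[R]_n) 0 j)) => // j.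
      by have := Aw j; rewrite /= in_itv /= => /andP[aj _]; rewrite gt_eqF// (lt_le_trans a0).
    by apply: cvgM.
  apply: (@bigsum_cvg _ _ (nbhs w) _ _ (fun j (v : 'rV[R]_n) =>
    (weighted_row m (v 0) *m range_defect M m) 0 j ^+ 2)) => j; rewrite expr2.
  have rc : (weighted_row m (v 0) *m range_defect M m) 0 j @[v --> w] -->
      (weighted_row m (w 0) *m range_defect M m) 0 j.
    rewrite mxE; under eq_fun do rewrite mxE.
    apply: (@bigsum_cvg _ _ (nbhs w) _ _ (fun i (v : 'rV[R]_n) =>
      weighted_row m (v 0) 0 i * range_defect M m i j)) => i.
    apply: cvgM; [| exact: cvg_cst].
    rewrite mxE; under eq_fun do rewrite mxE.
    by apply: cvgM; [exact: cvg_cst | exact: cw].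
  by apply: cvgM.
have [c cinA cmin] := EVT_min_rV A0 cA cf.
have f0 (w : 'rV[R]_n) : 0 <= \sum_i residual M l m alpha (w 0) i ^+ 2 :> R.
  by apply: sumr_ge0 => i _; exact: sqr_ge0.
have g0 (w : 'rV[R]_n) : 0 <= \sum_j (weighted_row m (w 0) *m range_defect M m) 0 j ^+ 2.
  by apply: sumr_ge0 => i _; exact: sqr_ge0.
(* A positive minimum would contradict [H] with [e = f c]. *)
have fc : f c <= 0.
  rewrite leNgt; apply/negP => fc0; have [k [aw]] := H _ fc0.
  by rewrite -fk ltNge cmin// inE; exact: Ak.
have [r0 q0] : \sum_i residual M l m alpha (c 0) i ^+ 2 = 0 /\
    \sum_j (weighted_row m (c 0) *m range_defect M m) 0 j ^+ 2 = 0.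
  by move: fc (f0 c) (g0 c); rewrite /f => ? ? ?; split; lra.
exists (c 0); split.
- by move=> j; move: cinA; rewrite inE => /(_ j) /=; rewrite in_itv.
- move=> i; apply/eqP; rewrite -sqrf_eq0; apply/eqP.
  by apply: (psumr_eq0P _ r0) => // j _; exact: sqr_ge0.
- apply/rowP => j; rewrite [RHS]mxE; apply/eqP; rewrite -sqrf_eq0; apply/eqP.
  by apply: (psumr_eq0P _ q0) => // i _; exact: sqr_ge0.
Qed.

(** * Convergence of the gradient flow *)

(** The last hypothesis rewrites the linear part of the energy as a positive combination of the
    lengths. The energy then bounds the lengths from above, and with [a0] below they stay in a box
    where the comparisons between gap and residual are uniform. *)
Lemma convex_energy_flow_cvg (R : realType) n (M : 'I_n -> 'I_n -> R)
    (l m ph : 'I_n -> R) (alpha a0 T : R) (k : 'I_n -> R -> R) :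
  let L j t := \sum_i M j i * k i t in
  let E i t := residual M l m alpha (L^~ t) i in
  (forall i j, M i j = M j i) -> 0 < alpha -> 0 < a0 ->
  (forall j, 0 <= m j) -> (forall j, 0 < ph j) ->
  (forall j t, T <= t -> a0 <= L j t) ->
  (forall i t, T <= t -> is_derive t 1 (k i) (- ph i * E i t / L i t)) ->
  (forall t, T <= t -> \sum_i ph i * L i t = \sum_i l i * k i t) ->
  exists kinf : 'I_n -> R, let Linf j := \sum_i M j i * kinf i in
    [/\ forall i, k i t @[t --> +oo] --> kinf i,
        forall i, a0 <= Linf i
      & forall i, residual M l m alpha Linf i = 0].
Proof.
move=> L E Ms al0 a00 m0 ph0 aL Hk bal.
have L0 j t : T <= t -> 0 < L j t by move=> /(aL j); exact: lt_le_trans.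
pose dk i t := - ph i * E i t / L i t.
pose dL j t := \sum_i M j i * dk i t.
have HL j t : T <= t -> is_derive t 1 (L j) (dL j t).
  move=> Tt; apply: is_derive_bigsum => i; have ? := Hk i t Tt.
  by apply: is_derive_eq; rewrite /dk /GRing.scale /=; ring.
(* The rate at which the energy [F] is dissipated. *)
pose diss t := \sum_i ph i / L i t * E i t ^+ 2.
have diss_ge0 t : T <= t -> 0 <= diss t.
  move=> Tt; apply: sumr_ge0 => i _.
  by rewrite mulr_ge0 ?sqr_ge0// divr_ge0 ?ltW// L0.
(* Summation by parts, by the symmetry of [M]. *)
have MdL (v : 'I_n -> R) t : \sum_j v j * dL j t = \sum_i (\sum_j M i j * v j) * dk i t.
  under eq_bigr do rewrite mulr_sumr; rewrite exchange_big /=.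
  apply: eq_bigr => i _; rewrite mulr_suml; apply: eq_bigr => j _.
  by rewrite (Ms i); ring.
have Edk t : T <= t -> \sum_i E i t * dk i t = - diss t.
  move=> Tt; rewrite /diss -sumrN; apply: eq_bigr => i _; rewrite /dk.
  by field; rewrite gt_eqF// L0.
pose F t := \sum_i l i * k i t + alpha * \sum_j m j / L j t.
have HF t : T <= t -> is_derive t 1 F (- diss t).
  move=> Tt.
  have H1 : is_derive t 1 (fun t => \sum_i l i * k i t) (\sum_i l i * dk i t).
    apply: is_derive_bigsum => i; have ? := Hk i t Tt.
    by apply: is_derive_eq; rewrite /dk /GRing.scale /=; ring.
  have H2 : is_derive t 1 (fun t => \sum_j m j / L j t)
      (\sum_j - (m j / L j t ^+ 2) * dL j t).
    apply: is_derive_bigsum => j; have ? := HL j t Tt.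
    have Lj0 : L j t != 0 by rewrite gt_eqF// L0.
    have ? := is_deriveV Lj0 (HL j t Tt).
    by apply: is_derive_eq; rewrite /GRing.scale /=; field.
  apply: is_derive_eq; rewrite /GRing.scale /= -Edk//.
  rewrite MdL mulr_sumr -big_split /=; apply: eq_bigr => i _.
  rewrite /E /residual mulrBl; congr (_ + _).
  rewrite -!mulNr mulrA; congr (_ * _); rewrite mulNr -mulrN -sumrN; congr (_ * _).
  by apply: eq_bigr => j _; rewrite mulrN.
have Fdec t : T <= t -> F t <= F T.
  move=> Tt; apply: (nonincreasing_of_derive_le0 HF _ (lexx T) Tt) => s Ts.
  by rewrite oppr_le0 diss_ge0.
have phL_le j t : T <= t -> ph j * L j t <= F t.
  move=> Tt; rewrite /F -bal// (bigD1 j)//= -addrA lerDl addr_ge0//.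
    by apply: sumr_ge0 => i _; rewrite mulr_ge0 ?ltW// L0.
  by rewrite mulr_ge0 ?(ltW al0)// sumr_ge0// => i _; rewrite divr_ge0// ltW// L0.
have F0 t : T <= t -> 0 <= F t.
  move=> Tt; rewrite /F -bal// addr_ge0//.
    by apply: sumr_ge0 => i _; rewrite mulr_ge0 ?ltW// L0.
  by rewrite mulr_ge0 ?(ltW al0)// sumr_ge0// => i _; rewrite divr_ge0// ltW// L0.
(* Multiplying by [S] replaces dividing by the smallest [ph j]. *)
pose S := \sum_i (ph i)^-1.
have phS i : 1 <= ph i * S.
  rewrite /S (bigD1 i)//= mulrDr divff ?gt_eqF// lerDl mulr_ge0 ?(ltW (ph0 _))//.
  by rewrite sumr_ge0// => j _; rewrite invr_ge0 ltW.
have S0 : 0 <= S by rewrite sumr_ge0// => j _; rewrite invr_ge0 ltW.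
pose b := a0 + F T * S.
have bgt0 : 0 < b by rewrite ltr_pwDl// mulr_ge0// F0.
have boxL t : T <= t -> forall j, a0 <= L j t <= b.
  move=> Tt j; rewrite aL//= /b.
  have h1 : L j t <= L j t * (ph j * S) by rewrite ler_peMr ?phS// ltW// L0.
  have h2 : ph j * L j t * S <= F T * S.
    by rewrite ler_wpM2r// (le_trans (phL_le j t Tt))// Fdec.
  by lra.
pose E2 t := \sum_i E i t ^+ 2.
have E2_le t : T <= t -> E2 t <= (S * b + 1) * diss t.
  move=> Tt; rewrite mulrDl mul1r -[leLHS]addr0 lerD ?diss_ge0//.
  rewrite /E2 /diss mulr_sumr; apply: ler_sum => i _.
  rewrite [leRHS]mulrA -[leLHS]mul1r ler_wpM2r ?sqr_ge0//.
  rewrite mulrA ler_pdivlMr ?L0// mul1r.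
  have /andP[_ Lb] := boxL t Tt i.
  have -> : S * b * ph i = ph i * S * b by ring.
  by apply: (le_trans Lb); rewrite -[leLHS]mul1r ler_wpM2r ?(ltW bgt0).
have Sb0 : 0 < S * b + 1 by rewrite ltr_pwDr// mulr_ge0// ltW.
(* If [E2] stayed above [e], the energy would decrease at rate at least [d] and become negative in
   finite time. *)
have Esmall e : 0 < e -> exists k : 'I_n -> R,
    let w i := \sum_j M i j * k j in
    (forall j, a0 <= w j <= b) /\ \sum_i residual M l m alpha w i ^+ 2 < e.
  move=> e0; apply: contrapT => /forallNP hN.
  have E2e t : T <= t -> e <= E2 t.
    move=> Tt; rewrite leNgt; apply/negP => lt_e.
    by apply: (hN (k^~ t)); split; [exact: boxL|].
  pose d := e / (S * b + 1).
  have d0 : 0 < d by rewrite divr_gt0.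
  pose G t := F t + d * t.
  have HG t : T <= t -> is_derive t 1 G (- diss t + d).
    move=> Tt; have ? := HF t Tt.
    by apply: is_derive_eq; rewrite /GRing.scale /=; ring.
  (* By this time the energy would have lost at least [F T + 1]. *)
  pose t1 := T + (F T + 1) / d.
  have FT0 := F0 T (lexx T).
  have Tt1 : T <= t1 by rewrite lerDl divr_ge0 ?(ltW d0)//; lra.
  have : G t1 <= G T.
    apply: (nonincreasing_of_derive_le0 HG _ (lexx T) Tt1) => s Ts.
    rewrite addrC subr_le0 /d ler_pdivrMr// mulrC.
    exact: le_trans (E2e s Ts) (E2_le s Ts).
  rewrite /G /t1 mulrDr [d * (_ / d)]mulrC divfK ?gt_eqF//.
  by have := F0 _ Tt1; rewrite /t1; lra.
have [z [zbox Ez zr]] := residual_zero_exists Ms a00 Esmall.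
have z0 j : 0 < z j by have /andP[+ _] := zbox j; exact: lt_le_trans.
(* The excess of the energy over its tangent at [z]. The linear part cancels since the residual
   vanishes at [z], so [D] has the same derivative as [F]. *)
pose D t := alpha * \sum_j m j * ((L j t)^-1 - (z j)^-1 + (L j t - z j) / z j ^+ 2).
have HD t : T <= t -> is_derive t 1 D (- diss t).
  move=> Tt.
  have H2 : is_derive t 1
      (fun t => \sum_j m j * ((L j t)^-1 - (z j)^-1 + (L j t - z j) / z j ^+ 2))
      (\sum_j (m j / z j ^+ 2 - m j / L j t ^+ 2) * dL j t).
    apply: is_derive_bigsum => j; have ? := HL j t Tt.
    have Lj0 : L j t != 0 by rewrite gt_eqF// L0.
    have ? := is_deriveV Lj0 (HL j t Tt).
    have zj0 : z j != 0 by rewrite gt_eqF.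
    by apply: is_derive_eq; rewrite /GRing.scale /=; field; rewrite Lj0.
  apply: is_derive_eq; rewrite /GRing.scale /= -Edk//.
  rewrite MdL mulr_sumr; apply: eq_bigr => i _.
  rewrite mulrA; congr (_ * _).
  transitivity (E i t - residual M l m alpha z i); last by rewrite Ez subr0.
  rewrite /E /residual opprB addrC addrA subrK -mulrBr -sumrB.
  by congr (_ * _); apply: eq_bigr => j _; rewrite mulrBr.
have DE t : T <= t -> D t = alpha * \sum_j m j * (L j t - z j) ^+ 2 / (L j t * z j ^+ 2).
  move=> Tt; congr (_ * _); apply: eq_bigr => j _.
  by field; rewrite !gt_eqF// L0.
pose y t := gap m (L^~ t) z.
have D_le t : T <= t -> D t <= alpha / a0 ^+ 3 * y t.
  move=> Tt; rewrite DE// -mulrA ler_wpM2l ?(ltW al0)// /y /gap mulr_sumr.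
  apply: ler_sum => j _; rewrite [leLHS]mulrC ler_wpM2r ?(mulr_ge0 (m0 j) (sqr_ge0 _))//.
  have /andP[zj _] := zbox j.
  rewrite lef_pV2 ?posrE ?exprn_gt0 ?mulr_gt0 ?exprn_gt0 ?L0// exprS.
  by apply: ler_pM; rewrite ?exprn_ge0 ?lerXn2r ?nnegrE ?(ltW a00) ?aL// ltW.
have D_ge t : T <= t -> y t <= b ^+ 3 / alpha * D t.
  move=> Tt; rewrite DE// mulrA divfK ?gt_eqF// /y /gap mulr_sumr.
  apply: ler_sum => j _; rewrite [leRHS]mulrCA -[leLHS]mulr1 ler_wpM2l//.
    by rewrite mulr_ge0 ?sqr_ge0.
  have /andP[zj zb] := zbox j; have /andP[_ Lb] := boxL t Tt j.
  rewrite ler_pdivlMr ?mul1r; last by rewrite mulr_gt0 ?exprn_gt0 ?L0.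
  rewrite (exprS b 2); apply: ler_pM; rewrite ?exprn_ge0 ?(ltW (L0 j t Tt)) ?(ltW (z0 j))//.
  by rewrite lerXn2r ?nnegrE ?(ltW bgt0) ?(ltW (z0 j)).
have [C1 C10 PL] := gap_le_residual l b Ms al0 a00 m0.
have [C2 C20 RG] := residual_le_gap M l alpha b a00 m0.
have PLt : forall t, T <= t -> y t <= C1 * E2 t.
  by move=> t Tt; apply: PL => //; exact: boxL.
have RGt : forall t, T <= t -> E2 t <= C2 * y t.
  by move=> t Tt; apply: RG => //; exact: boxL.
(* The constant in [D t <= C3 * diss t], obtained by chaining [D_le], [PLt] and [E2_le]. *)
pose C3 := alpha / a0 ^+ 3 * C1 * (S * b + 1).
have aa0 : 0 < alpha / a0 ^+ 3 by rewrite divr_gt0 ?exprn_gt0.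
have C30 : 0 < C3 by rewrite /C3 mulr_gt0// mulr_gt0.
pose c := C3^-1.
have c0 : 0 < c by rewrite invr_gt0.
have Ddec t : T <= t -> - diss t <= - c * D t.
  move=> Tt; rewrite mulNr lerN2 /c mulrC ler_pdivrMr// mulrC /C3.
  apply: (le_trans (D_le t Tt)); rewrite -!(mulrA (alpha / a0 ^+ 3)) ler_wpM2l ?(ltW aa0)//.
  by apply: (le_trans (PLt t Tt)); rewrite -mulrA ler_wpM2l ?(ltW C10)// E2_le.
have {}Ddec := exp_decay HD Ddec.
pose K := C2 * (b ^+ 3 / alpha) * (D T * expR (c * T)).
have E2dec t : T <= t -> E2 t <= K * expR (- c * t).
  move=> Tt; apply: (le_trans (RGt t Tt)).
  rewrite /K -mulrA -(mulrA C2) ler_wpM2l ?(ltW C20)//.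
  apply: (le_trans (D_ge t Tt)); rewrite ler_wpM2l ?Ddec//.
  by rewrite divr_ge0 ?exprn_ge0 ?(ltW bgt0) ?(ltW al0).
have K0 : 0 <= K.
  rewrite -(pmulr_lge0 _ (expR_gt0 (- c * T))) (le_trans _ (E2dec T (lexx T)))//.
  by apply: sumr_ge0 => i _; exact: sqr_ge0.
(* Passing from [E2] to a single [E i] takes a square root, which halves the rate. *)
have Edec i t : T <= t -> `|E i t| <= Num.sqrt K * expR (- (c / 2) * t).
  move=> Tt.
  rewrite -(@ler_pXn2r _ 2) ?nnegrE ?mulr_ge0 ?sqrtr_ge0 ?expR_ge0//.
  rewrite exprMn sqr_sqrtr// real_normK ?num_real// -expRM_natl.
  have -> : 2%:R * (- (c / 2) * t) = - c * t by field.
  apply: le_trans (E2dec t Tt); rewrite /E2 (bigD1 i)//= lerDl.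
  by apply: sumr_ge0 => j _; exact: sqr_ge0.
have c20 : 0 < c / 2 by rewrite divr_gt0.
have : forall i, exists li : R, k i t @[t --> +oo] --> li.
  move=> i.
  apply: (cvg_of_derive_exp_bound c20 (Hk i) (K := ph i / a0 * Num.sqrt K)) => t Tt.
  rewrite normrM normrM normrN (gtr0_norm (ph0 i)) normfV (gtr0_norm (L0 i t Tt)).
  rewrite mulrAC -(mulrA (ph i / a0)); apply: ler_pM => //; rewrite ?Edec//.
    by rewrite divr_ge0 ?ltW// L0.
  by rewrite ler_wpM2l ?(ltW (ph0 i))// lef_pV2 ?posrE ?L0// aL.
move=> /choice[kinf Hkinf]; exists kinf => Linf.
have cL j : L j t @[t --> +oo] --> Linf j.
  by apply: bigsum_cvg => i; apply: cvgM; [exact: cvg_cst | exact: Hkinf].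
have aLinf i : a0 <= Linf i.
  apply: (cvgr_to_ge (cL i)); near=> t; apply: aL; near: t.
  exact: nbhs_pinfty_ge (num_real _).
split => // i.
have Linf0 j : Linf j != 0 by rewrite gt_eqF// (lt_le_trans a00).
have cE : E i t @[t --> +oo] --> residual M l m alpha Linf i by exact: residual_cvg.
apply/eqP; rewrite -normr_le0.
have ce : Num.sqrt K * expR (- (c / 2) * t) @[t --> +oo] --> Num.sqrt K * 0.
  by apply: cvgM; [exact: cvg_cst | exact: expRN_cvg0].
have := ler_cvg_to (cvg_norm cE) ce; rewrite mulr0; apply.
near=> t; apply: Edec; near: t; exact: nbhs_pinfty_ge (num_real _).
Unshelve. all: by end_near.
Qed.

(** * Parallel polygonal curves *)

Lemma dotE (R : realType) (u v : plane R) :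
  dot u v = u 0 0 * v 0 0 + u 0 1 * v 0 1.
Proof.
rewrite /dot mxE !big_ord_recl big_ord0 addr0 !mxE.
by rewrite (_ : lift ord0 ord0 = 1)//; apply/val_inj.
Qed.

Lemma plane_eqP (R : realType) (u v : plane R) :
  u 0 0 = v 0 0 -> u 0 1 = v 0 1 -> u = v.
Proof.
move=> h0 h1; apply/rowP => -[[|[|//]] lt_j2].
  by rewrite (_ : Ordinal lt_j2 = 0)//; apply/val_inj.
by rewrite (_ : Ordinal lt_j2 = 1)//; apply/val_inj.
Qed.

Lemma rot90_0 (R : realType) (u : plane R) : rot90 u 0 0 = - u 0 1.
Proof. by rewrite mxE. Qed.

Lemma rot90_1 (R : realType) (u : plane R) : rot90 u 0 1 = u 0 0.
Proof. by rewrite mxE. Qed.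

Definition coordE := (dotE, rot90_0, rot90_1).

Lemma dotC (R : realType) (u v : plane R) : dot u v = dot v u.
Proof. by rewrite !coordE; ring. Qed.

Lemma dotDl (R : realType) (u v w : plane R) : dot (u + v) w = dot u w + dot v w.
Proof. by rewrite !coordE !mxE; ring. Qed.

Lemma dotDr (R : realType) (u v w : plane R) : dot u (v + w) = dot u v + dot u w.
Proof. by rewrite !coordE !mxE; ring. Qed.

Lemma dotNl (R : realType) (u v : plane R) : dot (- u) v = - dot u v.
Proof. by rewrite !coordE !mxE; ring. Qed.

Lemma dotNr (R : realType) (u v : plane R) : dot u (- v) = - dot u v.
Proof. by rewrite !coordE !mxE; ring. Qed.

Lemma dotZl (R : realType) (a : R) (u v : plane R) : dot (a *: u) v = a * dot u v.
Proof. by rewrite !coordE !mxE; ring. Qed.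

Lemma dotZr (R : realType) (a : R) (u v : plane R) : dot u (a *: v) = a * dot u v.
Proof. by rewrite !coordE !mxE; ring. Qed.

Lemma dot_rot90 (R : realType) (u v : plane R) : dot (rot90 u) (rot90 v) = dot u v.
Proof. by rewrite !coordE; ring. Qed.

Lemma dot_rot90_self (R : realType) (u : plane R) : dot (rot90 u) u = 0.
Proof. by rewrite !coordE; ring. Qed.

Lemma dot_rot90C (R : realType) (u v : plane R) : dot (rot90 u) v = - dot (rot90 v) u.
Proof. by rewrite !coordE; ring. Qed.

Lemma rot90Z (R : realType) (a : R) (u : plane R) : rot90 (a *: u) = a *: rot90 u.
Proof. by apply: plane_eqP; rewrite ?(coordE, mxE) ?(coordE, mxE) //= ; ring. Qed.

Lemma rot90_inj (R : realType) : injective (@rot90 R).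
Proof.
move=> u v e; apply: plane_eqP; first by rewrite -!rot90_1 e.
by apply: oppr_inj; rewrite -!rot90_0 e.
Qed.

Lemma dot_gt0 (R : realType) (u : plane R) : u != 0 -> 0 < dot u u.
Proof.
move=> u0; rewrite lt_neqAle eq_sym; apply/andP; split.
  apply: contra u0; rewrite dotE -!expr2 paddr_eq0 ?sqr_ge0// !sqrf_eq0 => /andP[/eqP h0 /eqP h1].
  by apply/eqP/plane_eqP; rewrite ?h0 ?h1 mxE.
by rewrite dotE -!expr2 addr_ge0 ?sqr_ge0.
Qed.

Lemma enorm_gt0 (R : realType) (u : plane R) : u != 0 -> 0 < enorm u.
Proof. by move=> u0; rewrite sqrtr_gt0 dot_gt0. Qed.

Lemma enormZ (R : realType) (a : R) (u : plane R) :
  0 <= a -> enorm (a *: u) = a * enorm u.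
Proof.
move=> a0; rewrite /enorm dotZl dotZr mulrA sqrtrM ?mulr_ge0//.
by rewrite -expr2 sqrtr_sqr ger0_norm.
Qed.

Lemma len_gt0 (R : realType) (S : segment R) : S.1 <> S.2 -> 0 < len S.
Proof. by move=> h; apply: enorm_gt0; rewrite subr_eq0 eq_sym; apply/eqP. Qed.

Lemma len_tangent (R : realType) (S : segment R) : S.1 <> S.2 ->
  S.2 - S.1 = len S *: tangent S.
Proof. by move=> /len_gt0 h; rewrite /tangent scalerA divff ?scale1r// gt_eqF. Qed.

Lemma dot_tangent (R : realType) (S : segment R) : S.1 <> S.2 ->
  dot (tangent S) (tangent S) = 1.
Proof.
move=> h; have l0 := len_gt0 h; rewrite /tangent dotZl dotZr.
have : len S ^+ 2 = dot (S.2 - S.1) (S.2 - S.1).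
  by rewrite sqr_sqrtr// ltW// dot_gt0// subr_eq0 eq_sym; apply/eqP.
by move=> <-; field; rewrite gt_eqF.
Qed.

Lemma segment_of_unit (R : realType) (S : segment R) (a : R) (u : plane R) :
  0 < a -> dot u u = 1 -> S.2 - S.1 = a *: u ->
  [/\ S.1 <> S.2, len S = a & tangent S = u].
Proof.
move=> a0 u1 e.
have lS : len S = a by rewrite /len e enormZ ?ltW// /enorm u1 sqrtr1 mulr1.
split => //.
  move=> h; move: lS; rewrite /len h subrr /enorm dotE !mxE !mul0r addr0 sqrtr0.
  by move=> a_eq0; move: a0; rewrite -a_eq0 ltxx.
by rewrite /tangent lS e scalerA mulVf ?scale1r// gt_eqF.
Qed.

Lemma unit_decomposition (R : realType) (u v : plane R) : dot u u = 1 ->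
  v = dot (rot90 u) v *: rot90 u + dot u v *: u.
Proof.
rewrite !coordE => h; apply: plane_eqP; rewrite !mxE /=.
  transitivity ((u 0 0 * u 0 0 + u 0 1 * u 0 1) * v 0 0); first by rewrite h mul1r.
  by ring.
transitivity ((u 0 0 * u 0 0 + u 0 1 * u 0 1) * v 0 1); first by rewrite h mul1r.
by ring.
Qed.

Lemma cross_sqr (R : realType) (u v : plane R) : dot u u = 1 -> dot v v = 1 ->
  dot (rot90 u) v ^+ 2 = 1 - dot u v ^+ 2.
Proof.
move=> hu hv; transitivity (dot u u * dot v v - dot u v ^+ 2); last by rewrite hu hv mulr1.
by rewrite !coordE; ring.
Qed.

(** The two scalar products tested in [angle] are both positive multiples of the cross product of
    the tangents, so a single sign decides. *)
Lemma angleE (R : realType) (S T : segment R) : S.1 <> S.2 -> T.1 <> T.2 ->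
  let a := acos (- dot (tangent S) (tangent T)) in
  angle S T = if 0 < dot (rot90 (tangent S)) (tangent T) then a else 2 * pi - a.
Proof.
move=> hS hT; have lS := len_gt0 hS; have lT := len_gt0 hT.
rewrite /angle (_ : S.1 - S.2 = - (S.2 - S.1)); last by rewrite opprB.
rewrite -/(len T) (_ : enorm (- (S.2 - S.1)) = len S); last first.
  by rewrite /len /enorm dotNl dotNr opprK.
rewrite /normal (len_tangent hS) (len_tangent hT).
move: (tangent S) (tangent T) => u v.
rewrite dotNl dotNr !dotZl !dotZr -mulrN -dot_rot90C !pmulr_rgt0// andbb.
by rewrite (_ : - _ / _ = - dot u v)//; field; rewrite !gt_eqF.
Qed.

(** With [x] the cross product and [d] the scalar product of the unit tangents, [x^2 + d^2 = 1], so
    the sine of [acos (- d)] is [|x|]. Replacing the angle by its complement to [2 * pi] when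
    [x < 0] restores the sign. *)
Lemma angle_spec (R : realType) (S T : segment R) : S.1 <> S.2 -> T.1 <> T.2 ->
  ~ parallel_seg S T ->
  [/\ cos (angle S T) = - dot (tangent S) (tangent T),
      sin (angle S T) = dot (rot90 (tangent S)) (tangent T),
      dot (rot90 (tangent S)) (tangent T) != 0,
      (angle S T \in `]0, pi[) = (0 < dot (rot90 (tangent S)) (tangent T))
    & (angle S T \in `]pi, 2 * pi[) = (dot (rot90 (tangent S)) (tangent T) < 0)].
Proof.
move=> hS hT hST.
have lS := len_gt0 hS; have lT := len_gt0 hT.
have x0 : dot (rot90 (tangent S)) (tangent T) != 0.
  apply/eqP => x0; apply: hST; rewrite /parallel_seg (len_tangent hS) (len_tangent hT).
  by move: x0; move: (tangent S) (tangent T) => u v x0; rewrite rot90Z dotZl dotZr x0 !mulr0.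
have := angleE hS hT; have := cross_sqr (dot_tangent hS) (dot_tangent hT).
move: x0; set x := dot (rot90 _) _; set d := dot (tangent S) _ => x0 xd /= ->.
have x20 : 0 < x ^+ 2 by rewrite lt_neqAle sqr_ge0 andbT eq_sym sqrf_eq0.
have d1 : -1 < - d < 1 by apply/andP; split; nra.
have d1' : -1 <= - d <= 1 by case/andP: d1 => /ltW -> /ltW ->.
set a := acos (- d).
have a0 : 0 < a by apply: acos_gt0; case/andP: d1 => /ltW -> ->.
have api : a < pi by apply: acos_ltpi; case/andP: d1 => -> /ltW ->.
have ca : cos a = - d by have [] := acos_def d1'.
have sa : sin a = `|x| by rewrite sin_acos// sqrrN -xd sqrtr_sqr.
case: ltP => hx.
  split => //.
  - by rewrite sa gtr0_norm.
  - by rewrite in_itv /= a0 api.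
  - by rewrite in_itv /= ltNge (ltW api) /= ltNge ltW.
have {}hx : x < 0 by rewrite lt_neqAle x0.
have cE : 2 * pi - a = - a + pi *+ 2 by rewrite mulr_natl addrC.
split => //.
- by rewrite cE cosD2pi cosN.
- by rewrite cE sinD2pi sinN sa ltr0_norm ?opprK.
- rewrite in_itv /= [X in _ && X = _]ltNge (_ : pi <= _)/= ?andbF//; lra.
- rewrite in_itv /= hx; apply/andP; split; lra.
Qed.

(** * Signed distances, lengths and vertices *)

Definition tau (R : realType) n (p : 'I_n -> plane R) (i : 'I_n) : plane R :=
  tangent (edge p i).

(* Signed distance from the origin to the line of the i-th segment of [q],
   measured along the i-th normal of [p]. *)
Definition height (R : realType) n (p q : 'I_n -> plane R) (i : 'I_n) : R :=
  dot (q i) (rot90 (tau p i)).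

(* The lengths of a curve parallel to [p] are the image of its signed distances
   under this matrix. *)
Definition length_mx (R : realType) n (p : 'I_n -> plane R) (i j : 'I_n) : R :=
  - ((j == ord_pred i)%:R / sin (theta p i) +
     (j == i)%:R * (cot (theta p i) + cot (theta p (ordS i))) +
     (j == ordS i)%:R / sin (theta p (ordS i))).

(* The intersection of the lines at signed distances [k (ord_pred i)] and [k i]. *)
Definition vertex_at (R : realType) n (p : 'I_n -> plane R) (k : 'I_n -> R)
    (i : 'I_n) : plane R :=
  k i *: rot90 (tau p i) +
  ((k (ord_pred i) + cos (theta p i) * k i) / sin (theta p i)) *: tau p i.

Lemma theta_spec (R : realType) n (p : 'I_n -> plane R) (i : 'I_n) :
  closed_polygonal p ->
  [/\ cos (theta p i) = - dot (tau p (ord_pred i)) (tau p i),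
      sin (theta p i) = dot (rot90 (tau p (ord_pred i))) (tau p i),
      sin (theta p i) != 0,
      (theta p i \in `]0, pi[) = (0 < sin (theta p i))
    & (theta p i \in `]pi, 2 * pi[) = (sin (theta p i) < 0)].
Proof.
move=> [_ ne np].
by have [-> -> ? -> ->] := @angle_spec _ (edge p (ord_pred i)) (edge p i) (ne (ord_pred i)) (ne i) (np i).
Qed.

Lemma tau_unit (R : realType) n (p : 'I_n -> plane R) (i : 'I_n) :
  closed_polygonal p -> dot (tau p i) (tau p i) = 1.
Proof. by move=> [_ ne _]; exact: (dot_tangent (ne i : (edge p i).1 <> _)). Qed.

(** As the entries are sums of indicators, this holds even when some of [ord_pred i], [i] and
    [ordS i] coincide. *)
Lemma length_mx_sum (R : realType) n (p : 'I_n -> plane R) (f : 'I_n -> R) (i : 'I_n) :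
  \sum_j length_mx p i j * f j =
  - (f (ord_pred i) / sin (theta p i) +
     (cot (theta p i) + cot (theta p (ordS i))) * f i +
     f (ordS i) / sin (theta p (ordS i))).
Proof.
have pick (a : 'I_n) (c : R) : \sum_j (j == a)%:R * c * f j = c * f a.
  rewrite (bigD1 a)//= eqxx mul1r big1 ?addr0// => j /negPf ->.
  by rewrite !mul0r.
rewrite -(mulrC (sin (theta p i))^-1) -(mulrC (sin (theta p (ordS i)))^-1) -!pick.
rewrite -!big_split -sumrN /=; apply: eq_bigr => j _.
by rewrite /length_mx mulNr !mulrDl.
Qed.

(** The term coupling two consecutive segments depends only on the angle at their common vertex. *)
Lemma length_mx_sym (R : realType) n (p : 'I_n -> plane R) (i j : 'I_n) :
  length_mx p i j = length_mx p j i.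
Proof.
have adj (a b : 'I_n) : (b == ord_pred a) = (a == ordS b).
  by apply/eqP/eqP => [->|->]; rewrite ?ord_predK ?ordSK.
have part (a b : 'I_n) : (b == ord_pred a)%:R / sin (theta p a) =
    (a == ordS b)%:R / sin (theta p (ordS b)).
  by rewrite adj; case: eqP => [->//|_]; rewrite !mul0r.
rewrite /length_mx part -(part j i) [j == i]eq_sym.
have -> : (i == j)%:R * (cot (theta p j) + cot (theta p (ordS j))) =
   (i == j)%:R * (cot (theta p i) + cot (theta p (ordS i))).
  by case: eqP => [->//|_]; rewrite !mul0r.
by congr (- _); ring.
Qed.

(** Both vertices lie on the i-th line. The coefficient is computed by writing the next tangent and
    its normal in the frame of [tau p i]. *)
Lemma vertex_at_edge (R : realType) n (p : 'I_n -> plane R) (k : 'I_n -> R) (i : 'I_n) :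
  closed_polygonal p ->
  vertex_at p k (ordS i) - vertex_at p k i = (\sum_j length_mx p i j * k j) *: tau p i.
Proof.
move=> cp; rewrite length_mx_sum /vertex_at ordSK /cot.
have [cS sS sS0 _ _] := theta_spec (ordS i) cp.
have [_ _ s0 _ _] := theta_spec i cp.
rewrite ordSK in cS sS.
have e1 := unit_decomposition (tau p (ordS i)) (tau_unit i cp).
have e2 := unit_decomposition (tau p i) (tau_unit (ordS i) cp).
rewrite dot_rot90C -sS (dotC (tau p (ordS i))) in e2.
rewrite -sS in e1.
have {}cS : dot (tau p i) (tau p (ordS i)) = - cos (theta p (ordS i)).
  by rewrite cS opprK.
move: e1 e2 s0 sS0; rewrite cS.
move: (tau p i) (tau p (ordS i)) => a b.
move: (sin _) (cos _) (sin _) (cos _) => s c s' c' e1 e2 s0 s'0.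
have rot_b : rot90 b = - (s'^-1 *: a) - (c' / s') *: b.
  have -> : s'^-1 *: a = s'^-1 *: (- s' *: rot90 b + - c' *: b) by rewrite -e2.
  by apply: plane_eqP; rewrite !mxE /=; field.
rewrite rot_b [in LHS]e1; apply: plane_eqP; rewrite !mxE /=; field; by rewrite s0 s'0.
Qed.

Lemma parallel_tau (R : realType) n (p q : 'I_n -> plane R) (i : 'I_n) :
  parallel_curve p q -> tau q i = tau p i.
Proof. by move=> /(_ i)[_ _]; exact: rot90_inj. Qed.

Lemma parallel_edge (R : realType) n (p q : 'I_n -> plane R) (i : 'I_n) :
  parallel_curve p q -> q (ordS i) - q i = len (edge q i) *: tau p i.
Proof.
move=> pq; rewrite -(parallel_tau i pq); apply: (@len_tangent _ (edge q i)).
by have [] := pq i.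
Qed.

Lemma height_ordS (R : realType) n (p q : 'I_n -> plane R) (i : 'I_n) :
  parallel_curve p q -> dot (q (ordS i)) (rot90 (tau p i)) = height p q i.
Proof.
move=> pq; rewrite -(subrK (q i) (q (ordS i))) (parallel_edge i pq) dotDl dotZl.
by rewrite dotC dot_rot90_self mulr0 add0r.
Qed.

(** The vertex lies on the lines of two consecutive segments; since the sine of their angle is
    nonzero, its two signed distances determine its tangential coordinate. *)
Lemma vertex_at_height (R : realType) n (p q : 'I_n -> plane R) (i : 'I_n) :
  closed_polygonal p -> parallel_curve p q -> q i = vertex_at p (height p q) i.
Proof.
move=> cp pq; rewrite [LHS](unit_decomposition _ (tau_unit i cp)) /vertex_at.
rewrite (dotC (rot90 _)); congr (_ + _ *: _).
rewrite -(height_ordS (ord_pred i) pq) ord_predK /height.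
have [-> sE s0 _ _] := theta_spec i cp; rewrite sE in s0 *.
have := unit_decomposition (rot90 (tau p (ord_pred i))) (tau_unit i cp).
rewrite dot_rot90 (dotC (tau p i) (rot90 _)) (dotC (tau p i) (tau p _)).
move: (tau p _) (tau p i) s0 => a b; move: (dot (rot90 a) b) => s s0 ->.
by rewrite dotDr !dotZr (dotC b); field.
Qed.

(** * Quantities shared by parallel curves *)

Lemma parallel_normal (R : realType) n (p q : 'I_n -> plane R) (i : 'I_n) :
  parallel_curve p q -> normal (edge q i) = normal (edge p i).
Proof. by move=> /(_ i)[]. Qed.

Lemma parallel_facet (R : realType) (phi : plane R -> R) n (p q : 'I_n -> plane R)
    (i : 'I_n) :
  parallel_curve p q -> facet phi (edge q i) = facet phi (edge p i).
Proof. by move=> pq; rewrite /facet (parallel_normal i pq). Qed.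

Lemma parallel_admissible (R : realType) (phi : plane R -> R) n
    (p q : 'I_n -> plane R) :
  parallel_curve p q -> admissible phi p -> admissible phi q.
Proof.
move=> pq [h1 h2]; split => i; rewrite !(parallel_facet _ _ pq)//.
by rewrite (parallel_normal i pq).
Qed.

Lemma parallel_closed (R : realType) n (p q : 'I_n -> plane R) :
  parallel_curve p q -> closed_polygonal p -> closed_polygonal q.
Proof.
move=> pq cp; have [n0 _ _] := cp; split => // i; first by have [] := pq i.
rewrite /parallel_seg /= (parallel_edge i pq) (parallel_edge (ord_pred i) pq).
rewrite rot90Z dotZl dotZr; apply/eqP; rewrite !mulf_neq0//.
- by rewrite gt_eqF// len_gt0//=; have [] := pq (ord_pred i).
- by rewrite gt_eqF// len_gt0//=; have [] := pq i.
- by have [_ <-] := theta_spec i cp.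
Qed.

Lemma parallel_theta (R : realType) n (p q : 'I_n -> plane R) (i : 'I_n) :
  closed_polygonal p -> parallel_curve p q -> theta q i = theta p i.
Proof.
move=> cp pq; have [_ nq _] := parallel_closed pq cp; have [_ np _] := cp.
rewrite /theta (@angleE _ (edge q (ord_pred i)) (edge q i) (nq _) (nq _)).
rewrite (@angleE _ (edge p (ord_pred i)) (edge p i) (np _) (np _)).
by rewrite -!/(tau _ _) !(parallel_tau _ pq).
Qed.

Lemma parallel_transition (R : realType) n (p q : 'I_n -> plane R) (i : 'I_n) :
  closed_polygonal p -> parallel_curve p q -> transition q i = transition p i.
Proof. by move=> cp pq; rewrite /transition !(parallel_theta _ cp pq). Qed.

Lemma parallel_delta (R : realType) (phi : plane R -> R) n (p q : 'I_n -> plane R)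
    (i : 'I_n) :
  parallel_curve p q -> delta phi q i = delta phi p i.
Proof. by move=> pq; rewrite /delta (parallel_facet _ _ pq) (parallel_normal i pq). Qed.

Lemma parallel_len (R : realType) n (p q : 'I_n -> plane R) (i : 'I_n) :
  closed_polygonal p -> parallel_curve p q ->
  len (edge q i) = \sum_j length_mx p i j * height p q j.
Proof.
move=> cp pq; have := parallel_edge i pq.
rewrite {1}(vertex_at_height (ordS i) cp pq) {1}(vertex_at_height i cp pq).
rewrite vertex_at_edge// => /(congr1 (dot (tau p i))).
by rewrite dotZr dotZr (tau_unit i cp) !mulr1.
Qed.

(** This exhibits the gradient structure: the bracket in [elastic_term] is minus [length_mx] applied
    to the vector of the [c_j^2 delta_j / L_j^2]. *)
Lemma elastic_termE (R : realType) (phi : plane R -> R) (alpha : R) n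
    (p q : 'I_n -> plane R) (i : 'I_n) :
  closed_polygonal p -> parallel_curve p q ->
  elastic_term phi alpha q i =
  residual (length_mx p) (fun j => transition p j * len (facet phi (edge p j)))
    (fun j => transition p j ^+ 2 * delta phi p j) alpha
    (fun j => len (edge q j)) i.
Proof.
move=> cp pq; rewrite /residual length_mx_sum /elastic_term.
rewrite !(parallel_transition _ cp pq) !(parallel_delta _ _ pq).
rewrite !(parallel_theta _ cp pq) (parallel_facet _ _ pq) mulrN opprK.
by congr (_ + _ * (_ + _ + _)); rewrite ?invfM; ring.
Qed.

(** * Wulff shape and total anisotropic length *)

Lemma facet_max (R : realType) (phi : plane R -> R) (F : segment R) (x : plane R) :
  is_facet phi F -> [set F.1; F.2] x ->
  wulff phi x /\ forall y, wulff phi y -> dot y (normal F) <= dot x (normal F).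
Proof.
move=> [_ eF] xF; suff: seg_set F x by rewrite eF.
case: xF => ->.
  by exists 0; [rewrite /= in_itv /= lexx ler01 | rewrite scale0r addr0].
by exists 1; [rewrite /= in_itv /= lexx ler01 | rewrite scale1r addrC subrK].
Qed.

Lemma polar_facet (R : realType) (phi : plane R -> R) (F : segment R) (x : plane R) :
  is_facet phi F -> [set F.1; F.2] x -> polar phi (normal F) = dot x (normal F).
Proof.
move=> fF xF; have [Wx mx] := facet_max fF xF.
have ub : ubound [set dot (normal F) y | y in wulff phi] (dot x (normal F)).
  by move=> _ [y Wy <-]; rewrite dotC; exact: mx.
apply/eqP; rewrite eq_le; apply/andP; split.
  by apply: ge_sup ub; exists (dot (normal F) x); exists x.
by apply: ub_le_sup; [exists (dot x (normal F)) | exists x => //; exact: dotC].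
Qed.

Lemma polar_gt0 (R : realType) (phi : plane R -> R) (F : segment R) :
  anisotropy phi -> is_facet phi F -> 0 < polar phi (normal F).
Proof.
move=> [_ _ hom [c [C [c0 bnd]]]] fF.
have F1 : [set F.1; F.2] F.1 by left.
rewrite (polar_facet fF F1).
have [_ mx] := facet_max fF F1.
have nu1 : dot (normal F) (normal F) = 1 by rewrite dot_rot90 dot_tangent//; case: fF.
have C1 : 0 < 1 + `|C| by rewrite ltr_pwDl.
(* This multiple of the normal lies in the Wulff shape, since [phi] is at most [C] on unit
   vectors. *)
apply: lt_le_trans (mx ((1 + `|C|)^-1 *: normal F) _).
  by rewrite dotZl nu1 mulr1 invr_gt0.
rewrite /wulff /= hom ?invr_ge0 ?(ltW C1)// mulrC ler_pdivrMr// mul1r.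
have [_] := bnd (normal F); rewrite /enorm nu1 sqrtr1 mulr1 => /le_trans; apply.
by rewrite (le_trans (ler_norm C))// lerDr.
Qed.

(** Any other pairing of endpoints would put an endpoint of one facet strictly beyond the supporting
    line of the other. *)
Lemma common_vertex_turn (R : realType) (phi : plane R -> R) (F G : segment R) :
  is_facet phi F -> is_facet phi G -> common_vertex F G ->
  (0 < dot (rot90 (tangent F)) (tangent G) -> F.1 = G.2) /\
  (dot (rot90 (tangent F)) (tangent G) < 0 -> F.2 = G.1).
Proof.
move=> fF fG [v [vF vG]].
have [neF _] := fF; have [neG _] := fG.
have [_ mF] := facet_max fF vF; have [_ mG] := facet_max fG vG.
have WF x : [set F.1; F.2] x -> wulff phi x by move=> /(facet_max fF)[].
have WG x : [set G.1; G.2] x -> wulff phi x by move=> /(facet_max fG)[].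
have lF := len_gt0 neF; have lG := len_gt0 neG.
have eF := len_tangent neF; have eG := len_tangent neG.
pose x := dot (rot90 (tangent F)) (tangent G); rewrite -/x.
have dF y : dot (y - v) (normal F) <= 0 \/ ~ wulff phi y.
  have [Wy|] := pselect (wulff phi y); [left|by right].
  by rewrite dotDl dotNl subr_le0 mF.
have dG y : dot (y - v) (normal G) <= 0 \/ ~ wulff phi y.
  have [Wy|] := pselect (wulff phi y); [left|by right].
  by rewrite dotDl dotNl subr_le0 mG.
have xG : dot (G.2 - G.1) (normal F) = len G * x.
  rewrite eG /x /normal; move: (tangent G) (tangent F) => g f.
  by rewrite dotZl (dotC g).
have xF : dot (F.2 - F.1) (normal G) = - (len F * x).
  rewrite eF /x /normal; move: (tangent G) (tangent F) => g f.
  by rewrite dotZl (dot_rot90C f) mulrN opprK (dotC f).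
have oF y z : dot (y - z) (normal G) = - dot (z - y) (normal G).
  by rewrite -dotNl opprB.
have oG y z : dot (y - z) (normal F) = - dot (z - y) (normal F).
  by rewrite -dotNl opprB.
split=> hx.
- have -> : F.1 = v.
    case: vF => // vF; have := dG F.1; case; last by case; apply: WF; left.
    by rewrite vF oF xF opprK pmulr_rle0// leNgt hx.
  case: vG => // vG; have := dF G.2; case; last by case; apply: WG; right.
  by rewrite vG xG pmulr_rle0// leNgt hx.
- have -> : F.2 = v.
    case: vF => // vF; have := dG F.2; case; last by case; apply: WF; right.
    by rewrite vF xF oppr_le0 pmulr_rge0// leNgt hx.
  case: vG => // vG; have := dF G.1; case; last by case; apply: WG; left.
  by rewrite vG oG xG oppr_le0 pmulr_rge0// leNgt hx.
Qed.

(* The vertex of the Wulff shape shared by the facets of the segments meeting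
   at the i-th vertex of [p]. *)
Definition wulff_vertex (R : realType) (phi : plane R -> R) n
    (p : 'I_n -> plane R) (i : 'I_n) : plane R :=
  let F := facet phi (edge p i) in if 0 < sin (theta p i) then F.2 else F.1.

Lemma facet_tangent (R : realType) (phi : plane R -> R) n (p : 'I_n -> plane R)
    (i : 'I_n) :
  admissible phi p -> tangent (facet phi (edge p i)) = tau p i.
Proof. by move=> [/(_ i)[_ e] _]; apply/esym/rot90_inj; exact: e. Qed.

(** When both turns have the same sign, the two vertices are opposite ends of the facet, in the
    order given by the sign of the transition number; otherwise they coincide and the transition
    number is 0. *)
Lemma wulff_vertex_diff (R : realType) (phi : plane R -> R) n (p : 'I_n -> plane R)
    (i : 'I_n) :
  closed_polygonal p -> admissible phi p ->
  wulff_vertex phi p (ordS i) - wulff_vertex phi p i =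
  (transition p i * len (facet phi (edge p i))) *: tau p i.
Proof.
move=> cp ap; have [fa cv] := ap.
have [fi _] := fa i; have [fS _] := fa (ordS i).
have [_ sS sS0 lS rS] := theta_spec (ordS i) cp.
have [_ _ s0 l0 r0] := theta_spec i cp.
have := cv (ordS i); rewrite ordSK => /(common_vertex_turn fi fS).
rewrite ordSK in sS; rewrite !facet_tangent// -sS => -[hl hr].
have d := len_tangent fi.1; rewrite facet_tangent// in d.
rewrite /wulff_vertex /transition l0 r0 lS rS.
have [hS|hS] := ltP 0 (sin (theta p (ordS i))); last first.
  have {}hS : sin (theta p (ordS i)) < 0 by rewrite lt_neqAle sS0.
  rewrite -hr// hS.
  have [h|h] := ltP 0 (sin (theta p i)).
    by rewrite ltNge (ltW h) /= mul0r scale0r subrr.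
  by rewrite lt_neqAle s0 h /= mul1r.
have nS : (sin (theta p (ordS i)) < 0) = false by rewrite ltNge ltW.
rewrite -hl// nS andbF andbT.
have [h|h] := ltP 0 (sin (theta p i)); last by rewrite mul0r scale0r subrr.
by rewrite mulN1r scaleNr -d opprB.
Qed.

(* Summation by parts: the polar at the i-th normal is attained at the i-th
   [wulff_vertex]. *)
Lemma anisotropic_length (R : realType) (phi : plane R -> R) n
    (p q : 'I_n -> plane R) :
  closed_polygonal p -> admissible phi p -> parallel_curve p q ->
  \sum_i polar phi (normal (edge p i)) * len (edge q i) =
  \sum_i transition p i * len (facet phi (edge p i)) * height p q i.
Proof.
move=> cp ap pq; have [fa _] := ap.
pose V := wulff_vertex phi p; pose r i := rot90 (q i).
have term i : polar phi (normal (edge p i)) * len (edge q i) =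
    dot (V i) (r (ordS i)) - dot (V i) (r i).
  have [fi ->] := fa i.
  have Vi : [set (facet phi (edge p i)).1; (facet phi (edge p i)).2] (V i).
    by rewrite /V /wulff_vertex; case: ifP; [right|left].
  rewrite (polar_facet fi Vi) /normal facet_tangent//.
  rewrite -dotNr -dotDr mulrC -dotZr -rot90Z -(parallel_edge i pq); congr dot.
  by apply: plane_eqP; rewrite /r !(rot90_0, rot90_1) ?mxE ?(rot90_0, rot90_1) ?mxE//=; ring.
under eq_bigr do rewrite term.
have ordS_inj : injective (@ordS n) := can_inj (@ordSK n).
rewrite sumrB [X in _ - X](reindex_inj ordS_inj) -sumrB.
apply: eq_bigr => i _; rewrite -dotNl -dotDl -opprB dotNl /V wulff_vertex_diff//.
by rewrite dotZl dotC /r dot_rot90C -(height_ordS i pq) mulrN opprK dotC.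
Qed.

(** * Convergence of the flow *)

Lemma seg_line_normal (R : realType) (S : segment R) : S.1 <> S.2 ->
  seg_line S = [set x | dot x (normal S) = dot S.1 (normal S)].
Proof.
move=> neS; have l0 := len_gt0 neS; have e := len_tangent neS.
have u1 := dot_tangent neS.
rewrite /seg_line /normal e; move: (tangent S) u1 => u u1.
apply/seteqP; split=> x /=.
  move=> [t _ <-]; rewrite dotDl !dotZl (dotC u) dot_rot90_self !mulr0 addr0//.
move=> ex; exists (dot u (x - S.1) / len S) => //.
rewrite scalerA divfK ?gt_eqF//.
have := unit_decomposition (x - S.1) u1.
by rewrite (dotC (rot90 u)) dotDl dotNl ex subrr scale0r add0r => <-; rewrite addrC subrK.
Qed.

Lemma displacement_height (R : realType) n (p q : 'I_n -> plane R) (i : 'I_n) :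
  closed_polygonal p -> parallel_curve p q ->
  dot (displacement (edge p i) (edge q i)) (normal (edge p i)) =
  height p q i - height p p i.
Proof.
move=> cp pq; have [_ np _] := cp; have [nq _ _] := pq i.
have lp := seg_line_normal (np i : (edge p i).1 <> (edge p i).2).
have lq := seg_line_normal (nq : (edge q i).1 <> (edge q i).2).
rewrite (parallel_normal i pq) in lq.
have nn : dot (normal (edge p i)) (normal (edge p i)) = 1.
  by rewrite dot_rot90 (tau_unit i cp).
have nt a : dot (a *: normal (edge p i)) (tau p i) = 0.
  by rewrite dotZl dot_rot90_self mulr0.
have ep := len_tangent (np i : (edge p i).1 <> (edge p i).2).
have eq_ := parallel_edge i pq.
rewrite /displacement; set D := [set v : plane R | _].
(* [displacement] is a choice, so its set must be shown nonempty; afterwards, following the point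
   [p i] fixes the normal component of the chosen vector. *)
have /getPex : exists v, D v.
  exists ((height p q i - height p p i) *: normal (edge p i)); split.
  - by rewrite ep dotZr nt mulr0.
  - by rewrite /= eq_ dotZr nt mulr0.
  - rewrite lp lq; apply/seteqP; split=> x /=.
      move=> ex; exists (x - (height p q i - height p p i) *: normal (edge p i)).
        by rewrite dotDl dotNl dotZl nn mulr1 ex /height; ring.
      by rewrite subrK.
    by move=> [y ey <-]; rewrite dotDl dotZl nn mulr1 ey /height; ring.
move=> [_ _]; rewrite lp lq; set v := get _ => /seteqP[_ /(_ ((edge p i).1 + v))].
move=> /(_ _)/=; rewrite dotDl => h.
have {h} : dot (p i) (normal (edge p i)) + dot v (normal (edge p i)) =
  dot (q i) (normal (edge p i)) by apply: h; exists (p i).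
by rewrite /height -/(normal _) => <-; rewrite /normal /tau; ring.
Qed.

(** The signed distance differs from [h_i] by a constant, but only at nonnegative times; this
    suffices near [t > 0]. *)
Lemma flow_height_derive (R : realType) (phi : plane R -> R) (alpha : R) n
    (p0 : 'I_n -> plane R) (p : R -> 'I_n -> plane R) (i : 'I_n) (t : R) :
  closed_polygonal p0 -> elastic_flow phi alpha p0 p +oo -> 0 < t ->
  is_derive t 1 (fun s => height p0 (p s) i)
    (- polar phi (normal (edge p0 i)) * elastic_term phi alpha (p t) i
      / len (edge (p t) i)).
Proof.
move=> cp [_ par fl] t0; have [_ _ dh _ eh] := fl i.
have {}par s : 0 <= s -> parallel_curve p0 (p s) by move=> s0; apply: par => //; exact: ltry.
have {dh eh} := (derivableP (dh t t0 (ltry t)), eh t t0 (ltry t)).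
set h := (fun s => dot (displacement _ _) _) => -[hd].
rewrite derive1E => e; rewrite -e.
apply: (@near_eq_is_derive _ _ _ (fun s => h s + height p0 p0 i)).
  near=> s; rewrite /h displacement_height ?subrK//; apply: par; apply: ltW.
  near: s; apply: open_nbhs_nbhs; split => //; exact: open_gt.
by apply: is_derive_eq; rewrite addr0.
Unshelve. all: by end_near.
Qed.

(** * From convergence of vertices to Kuratowski convergence *)

Lemma curve_set_closed (R : realType) n (p : 'I_n -> plane R) :
  closed (curve_set (Curve p)).
Proof.
apply: closed_bigcup => [|i _]; first exact: finite_finset.
apply: compact_closed; first exact: norm_hausdorff.
apply: continuous_compact; last exact: segment_compact.
apply: continuous_subspaceT => t.
by apply: cvgD; [exact: cvg_cst | apply: cvgZ; [exact: cvg_id | exact: cvg_cst]].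
Qed.

(** Points with the same index and parameter on the two curves are close. This gives the cycle of
    inclusions from the limit curve to the lower limit, to the upper limit, and back, the last step
    using that the curve is closed. *)
Lemma kuratowski_cvg_vertices (R : realType) (F : set_system R) n
    (A : R -> set (plane R)) (p : R -> 'I_n -> plane R) (q : 'I_n -> plane R) :
  ProperFilter F ->
  (\forall t \near F, A t = curve_set (Curve (p t))) ->
  (forall i, p t i @[t --> F] --> q i) ->
  kuratowski_cvg F A (curve_set (Curve q)).
Proof.
move=> FF eA pq.
have lim_lower : curve_set (Curve q) `<=` lower_limit F A.
  move=> _ [i _ [s s01 <-]] U /= nU.
  have cx : p t i + s *: (p t (ordS i) - p t i) @[t --> F] -->
      q i + s *: (q (ordS i) - q i).
    apply: cvgD; first exact: pq.
    apply: cvgZ; first exact: cvg_cst.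
    by apply: cvgB; exact: pq.
  have := cx U nU; apply: filterS2 eA => t -> Ut.
  by exists (p t i + s *: (p t (ordS i) - p t i)); split=> //; exists i => //; exists s.
have lower_upper : lower_limit F A `<=` upper_limit F A.
  move=> x lx U B /lx AU FB; have [t [Bt AUt]] := filter_ex (filterI FB AU).
  by exists t.
have upper_lim : upper_limit F A `<=` curve_set (Curve q).
  move=> x ux; apply: curve_set_closed => B /nbhs_ballP[e /= e0 eB].
  have e20 : 0 < e / 2 by rewrite divr_gt0.
  have near_vertices : \forall t \near F, forall i, `|q i - p t i| < e / 2.
    by apply: filter_forall => i; move/cvgr_dist_lt: (pq i); apply.
  have [t [eAt dt] [y []]] := ux _ _ (nbhsx_ballx x _ e20) (filterI eA near_vertices).
  rewrite eAt => -[i _ [s]]; rewrite /= in_itv /= => /andP[s0 s1] <- xy.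
  exists (q i + s *: (q (ordS i) - q i)); split.
    by exists i => //; exists s => //=; rewrite in_itv /= s0.
  apply: eB; rewrite -ball_normE /=.
  set z := q i + _; set w := p t i + s *: (p t (ordS i) - p t i) in xy.
  rewrite -(subrK w x) -addrA (splitr e) (le_lt_trans (ler_normD _ _))//.
  apply: ltr_leD; first by move: xy; rewrite -ball_normE.
  have -> : w - z = - ((1 - s) *: (q i - p t i) + s *: (q (ordS i) - p t (ordS i))).
    by apply/rowP => j; rewrite !mxE; ring.
  rewrite normrN (le_trans (ler_normD _ _))// !normrZ ger0_norm ?subr_ge0// ger0_norm//.
  have -> : e / 2 = (1 - s) * (e / 2) + s * (e / 2) by ring.
  by rewrite lerD// ler_wpM2l ?subr_ge0// ltW.
split; apply/seteqP; split=> //.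
- exact: subset_trans lower_upper upper_lim.
- exact: subset_trans lim_lower lower_upper.
Qed.

Lemma parallel_of_tau (R : realType) n (p q : 'I_n -> plane R) :
  (forall i, p i <> p (ordS i)) -> (forall i, q i <> q (ordS i)) ->
  (forall i, tau q i = tau p i) -> parallel_curve p q.
Proof.
move=> np nq pq i; split => //; last by rewrite /normal -!/(tau _ _) pq.
rewrite /parallel_seg (len_tangent (np i : (edge p i).1 <> _)).
rewrite (len_tangent (nq i : (edge q i).1 <> _)) -!/(tau _ _) pq.
by rewrite rot90Z dotZl dotZr dot_rot90_self !mulr0.
Qed.

Lemma elastic_flow_cvg (R : realType) (phi : plane R -> R) (alpha : R) n
    (p0 : 'I_n -> plane R) (p : R -> 'I_n -> plane R) (T a0 : R) :
  anisotropy phi -> 0 < alpha -> closed_polygonal p0 -> admissible phi p0 ->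
  elastic_flow phi alpha p0 p +oo -> 0 < a0 ->
  (forall t, T <= t -> 0 <= t -> forall i, a0 <= len (edge (p t) i)) ->
  exists q : 'I_n -> plane R,
    [/\ stationary phi alpha q, parallel_curve p0 q
      & forall i, p t i @[t --> +oo] --> q i].
Proof.
move=> aphi al0 cp ap fl a00 aL.
have par t : 0 <= t -> parallel_curve p0 (p t).
  by move=> t0; have [_ par _] := fl; apply: par => //; exact: ltry.
(* The evolution law holds only at positive times. *)
pose T1 := Num.max T 1.
have TT1 : T <= T1 by rewrite le_max lexx.
have T10 t : T1 <= t -> 0 < t.
  by move=> T1t; apply: lt_le_trans T1t; rewrite lt_max ltr01 orbT.
pose k i t := height p0 (p t) i.
pose l i := transition p0 i * len (facet phi (edge p0 i)).
pose m i := transition p0 i ^+ 2 * delta phi p0 i.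
pose ph i := polar phi (normal (edge p0 i)).
have ph0 i : 0 < ph i.
  by have [/(_ i)[fi e] _] := ap; rewrite /ph e; exact: polar_gt0.
have m0 i : 0 <= m i.
  by rewrite /m mulr_ge0 ?sqr_ge0// /delta mulr_ge0 ?sqr_ge0// ltW// ph0.
have lenE t i : T1 <= t -> len (edge (p t) i) = \sum_j length_mx p0 i j * k j t.
  by move=> T1t; apply: parallel_len => //; apply: par; rewrite ltW// T10.
have aLk j t : T1 <= t -> a0 <= \sum_i length_mx p0 j i * k i t.
  by move=> T1t; rewrite -lenE//; apply: aL; [exact: le_trans T1t | rewrite ltW// T10].
have Hk i t : T1 <= t -> is_derive t 1 (k i) (- ph i *
    residual (length_mx p0) l m alpha (fun j => \sum_i length_mx p0 j i * k i t) i /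
    \sum_j length_mx p0 i j * k j t).
  move=> T1t; have := flow_height_derive i cp fl (T10 _ T1t).
  rewrite (elastic_termE _ _ _ cp (par _ (ltW (T10 _ T1t)))) lenE//.
  by under [X in residual _ _ _ _ X]eq_fun do rewrite lenE//.
have bal t : T1 <= t -> \sum_i ph i * (\sum_j length_mx p0 i j * k j t) =
    \sum_i l i * k i t.
  move=> T1t; rewrite -(anisotropic_length cp ap (par _ (ltW (T10 _ T1t)))).
  by apply: eq_bigr => i _; rewrite lenE.
have [kinf [ck aLinf Einf]] := convex_energy_flow_cvg (length_mx_sym p0) al0 a00
  m0 ph0 aLk Hk bal.
(* The limit curve is rebuilt from the limits of the signed distances; its lengths are at least
   [a0], so no segment degenerates. *)
pose q := vertex_at p0 kinf.
have edge_q i : [/\ q i <> q (ordS i),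
    len (edge q i) = \sum_j length_mx p0 i j * kinf j & tau q i = tau p0 i].
  apply: (@segment_of_unit _ (edge q i)); last exact: vertex_at_edge.
    exact: lt_le_trans (aLinf i).
  exact: tau_unit.
have pq : parallel_curve p0 q.
  by apply: parallel_of_tau => [|i|i]; [have [] := cp | have [] := edge_q i | have [] := edge_q i].
exists q; split => //.
  split; [exact: parallel_closed cp | exact: parallel_admissible ap | move=> i].
  rewrite (elastic_termE _ _ _ cp pq) -[RHS](Einf i); congr residual.
  by apply/funext => j; have [] := edge_q j.
move=> i; have : vertex_at p0 (k^~ t) i @[t --> +oo] --> q i.
  apply: cvgD; first by apply: cvgZ; [exact: ck | exact: cvg_cst].
  apply: cvgZ; last exact: cvg_cst.
  apply: cvgM; last exact: cvg_cst.
  by apply: cvgD; [exact: ck | apply: cvgM; [exact: cvg_cst | exact: ck]].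
apply: cvg_trans; apply: near_eq_cvg; near=> t.
apply/esym/vertex_at_height => //; apply: par.
near: t; exact: nbhs_pinfty_ge (num_real _).
Unshelve. all: by end_near.
Qed.

Lemma min_len_le (R : realType) n (p : 'I_n -> plane R) (a : R) (i : 'I_n) :
  (a%:E <= min_len (Curve p))%E -> a <= len (edge p i).
Proof.
rewrite -lee_fin => /le_trans; apply.
exact: (@bigmin_le _ _ _ _ i).
Qed.

Theorem theorem7p1 (R : realType) (phi : plane R -> R) (alpha : R)
    (G0 : curve R) (G : R -> curve R) :
  crystalline phi ->
  0 < alpha ->
  closed_polygonal G0 ->
  admissible phi G0 ->
  flow_with_restarts phi alpha G0 G ->
  forall T a0 : R,
    0 <= T -> 0 < a0 ->
    (a0%:E <= ereal_inf [set min_len (G t) | t in [set t : R | (T <= t)%R]])%E ->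
  exists Ginf : 'I_(nseg (G T)) -> plane R,
    [/\ stationary phi alpha Ginf,
        parallel_curve (G T) Ginf
      & kuratowski_cvg (+oo)%R (fun t => curve_set (G t))
          (curve_set (Curve Ginf))].
Proof.
move=> [aphi _] al0 _ _ [k [restart [_ restart0 restart_lt pieces _]]] T a0 T0 a00 hinf.
have min_ge t : T <= t -> (a0%:E <= min_len (G t))%E.
  by move=> Tt; apply: (le_trans hinf); apply: ereal_inf_lbound; exists t.
(* Just before a restart after [T], the length of some segment would tend to 0, against the lower
   bound [a0]. *)
have kT : restart k <= T.
  case: k => [|k] in restart_lt pieces *; first by rewrite restart0.
  rewrite leNgt; apply/negP => Tk.
  have [n [p [_ _ _ Gp /(_ (ltnSn k))[[i van] _]]]] := pieces k (leqnSn k).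
  rewrite (ltn_eqF (ltnSn k)) in Gp.
  have dk : 0 < restart k.+1 - restart k by rewrite subr_gt0 restart_lt.
  suff : a0 <= 0 by rewrite leNgt a00.
  apply: (cvgr_to_ge van); near=> t.
  have t0 : 0 < t by near: t; exact: nbhs_left_gt.
  have Tt : T - restart k < t by near: t; apply: nbhs_left_gt; rewrite ltrD2r.
  have tk : t < restart k.+1 - restart k by near: t; exact: nbhs_left_lt.
  apply: min_len_le; have := min_ge (t + restart k).
  rewrite Gp ?addrK; [apply; lra | lra | by rewrite lte_fin; lra].
have [n [p [cp ap [fl _] Gp _]]] := pieces k (leqnn k).
rewrite eqxx /= in fl Gp.
have {}Gp t : T <= t -> G t = Curve (p (t - restart k)).
  by move=> Tt; apply: Gp; [exact: le_trans Tt | exact: ltry].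
have [|q [sq pq cq]] := elastic_flow_cvg (T := T - restart k) aphi al0 cp ap fl a00.
  move=> t Tt _ i; apply: min_len_le; have := min_ge (t + restart k).
  by rewrite Gp ?addrK; [apply; lra | lra].
have GT := Gp T (lexx T).
rewrite GT; exists q; split => //.
  have [_ par _] := fl.
  (* The limit is known to be parallel to the last restart curve [p 0]; so is [G T], and the unit
     tangents agree. *)
  have pT : parallel_curve (p 0) (p (T - restart k)).
    by apply: par; [rewrite subr_ge0 | exact: ltry].
  apply: parallel_of_tau => i; [by have [] := pT i | by have [] := pq i |].
  by rewrite (parallel_tau i pq) (parallel_tau i pT).
apply: (@kuratowski_cvg_vertices _ _ _ _ (fun t => p (t - restart k))).
  near=> t; rewrite Gp//; near: t; exact: nbhs_pinfty_ge (num_real _).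
by move=> i; rewrite (cvg_centerr (restart k) (fun t => p t i)).
Unshelve. all: by end_near.
Qed.
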